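(* Let $A$ be a unital operator algebra and let $1\le\theta<c<\infty$ be fixed. Then the following are equivalent: (i) Every morphism in $\mathcal{C}_c$ is similar to a morphism in $\mathcal{C}_\theta$. (ii) Every bounded morphism $u\colon A\to B(H)$ is similar to one in $\mathcal{C}_\theta$.
   Context: A unital operator algebra is a closed unital subalgebra of some $B(H_0)$, not necessarily self-adjoint. A morphism is a unital homomorphism. For $c\ge1$, $\mathcal{C}_c$ is the class of all morphisms $u\colon A\to B(H)$ ($H$ a Hilbert space) with $\|u\|\le c$. Two morphisms $u_1\colon A\to B(H_1)$, $u_2\colon A\to B(H_2)$ are similar if there is a (bounded linear) isomorphism $\xi\colon H_1\to H_2$ such that $u_2(a)=\xi u_1(a)\xi^{-1}$ for all $a\in A$. *)

(* Defs.v *)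
From HB Require Import structures.
From mathcomp Require Import all_boot all_order all_algebra.
From mathcomp Require Import complex.
From mathcomp Require Import all_classical all_reals all_analysis.

Set Implicit Arguments.
Unset Strict Implicit.
Unset Printing Implicit Defensive.

Import Order.TTheory GRing.Theory Num.Theory.
Import Num.Def numFieldNormedType.Exports.

Local Open Scope classical_set_scope.
Local Open Scope ring_scope.
Local Open Scope complex_scope.

(* [inner] is linear in its first argument and conjugate-linear in the second
   one. *)
HB.mixin Record CompleteNormedModule_isHilbert (R : realType) H
    of CompleteNormedModule R[i] H := {
  inner : {dot H for conjC};
  normr_inner : forall x : H, `|x| ^+ 2 = inner x x
}.

#[short(type="hilbertType")]
HB.structure Definition Hilbert (R : realType) :=
  {H of CompleteNormedModule R[i] H & CompleteNormedModule_isHilbert R H}.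

Section operator_norm.
Context {R : realType} {V W : normedModType R[i]}.

(* The norm (possibly +oo) of [f] seen as a map on the subspace [A]. The norm
   of a normed module over R[i] takes its values in R[i], hence the [Re]. *)
Definition opnorm (A : set V) (f : V -> W) : \bar R :=
  ereal_sup [set (complex.Re `|f x|)%:E | x in A `&` [set x | `|x| <= 1]].

End operator_norm.

Section norm_facts.
Context {R : realType}.

Lemma Re_normE (V : normedZmodType R[i]) (x : V) : (complex.Re `|x|)%:C = `|x|.
Proof. by apply/RRe_real/ger0_real. Qed.

Lemma Re_norm_ge0 (V : normedZmodType R[i]) (x : V) : 0 <= complex.Re `|x|.
Proof. by rewrite -ler0c Re_normE. Qed.

Variables V W : normedModType R[i].

Lemma opnorm_ge0 (f : V -> W) : (0 <= opnorm setT f)%E.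
Proof.
apply: (@le_trans _ _ (complex.Re `|f 0|)%:E).
  by rewrite lee_fin Re_norm_ge0.
apply: ereal_sup_ubound.
by exists 0 => //; split => //=; rewrite normr0.
Qed.

Lemma opnorm_le (f : V -> W) (M : R) : 0 <= M ->
  (forall x, `|f x| <= M%:C * `|x|) -> (opnorm setT f <= M%:E)%E.
Proof.
move=> M0 fM; apply: ge_ereal_sup => _ [x [_ /= x1] <-].
rewrite lee_fin -lecR Re_normE (le_trans (fM x))//.
by rewrite ler_piMr// ler0c.
Qed.

Lemma opnormP (f : V -> W) (x : V) : linear f -> (opnorm setT f < +oo)%E ->
  `|f x| <= (fine (opnorm setT f))%:C * `|x|.
Proof.
move=> lf foo.
pose lfT : GRing.isLinear R[i] V W *:%R f := GRing.isLinear.Build _ _ _ _ f lf.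
pose F : {linear V -> W} := HB.pack f lfT.
have FE : f = F by [].
have fin : opnorm setT f \is a fin_num by rewrite ge0_fin_numE// opnorm_ge0.
have [->|x0] := eqVneq x 0; first by rewrite FE linear0 !normr0 mulr0.
have nx0 : 0 < `|x| by rewrite normr_gt0.
have : ((complex.Re `|f (`|x|^-1 *: x)|)%:E <= opnorm setT f)%E.
  apply: ereal_sup_ubound; exists (`|x|^-1 *: x) => //; split => //=.
  by rewrite normrZ normfV normr_id mulVf ?normr_eq0.
rewrite -(fineK fin) lee_fin -lecR Re_normE FE linearZ/= normrZ normfV normr_id.
by rewrite ler_pdivrMl// mulrC.
Qed.

End norm_facts.

Section bounded_operators.
Context {R : realType} (V W : normedModType R[i]).

Definition bounded_operator : {pred V -> W} :=
  mem [set f : V -> W | linear f /\ (opnorm setT f < +oo)%E].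

Record bop := Bop { bop_fun :> V -> W; _ : bop_fun \in bounded_operator }.

HB.instance Definition _ := [isSub for bop_fun].
HB.instance Definition _ := [Choice of bop by <:].

Lemma bounded_operatorP (f : V -> W) : linear f ->
  (exists2 M : R, 0 <= M & forall x, `|f x| <= M%:C * `|x|) ->
  f \in bounded_operator.
Proof.
move=> lf [M M0 fM]; apply/mem_set; split => //.
exact: le_lt_trans (opnorm_le M0 fM) (ltry _).
Qed.

Lemma bounded_operatorW (f : V -> W) : f \in bounded_operator ->
  linear f /\ exists2 M : R, 0 <= M & forall x, `|f x| <= M%:C * `|x|.
Proof.
move=> /set_mem[lf foo]; split => //; exists (fine (opnorm setT f)).
  exact/fine_ge0/opnorm_ge0.
by move=> x; exact: opnormP.
Qed.

Lemma bounded_operator_submod_closed : GRing.submod_closed bounded_operator.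
Proof.
split=> [|k f g /bounded_operatorW[lf [M M0 fM]] /bounded_operatorW[lg [N N0 gN]]].
  apply: bounded_operatorP => [k x y|].
    by rewrite /= scaler0 addr0.
  by exists 0 => // x; rewrite normr0 mul0r.
apply: bounded_operatorP => [l x y|].
  rewrite !fctE lf lg !scalerDr addrACA; congr (_ + _ + _).
  by rewrite !scalerA mulrC.
exists (complex.Re `|k| * M + N).
  by rewrite addr_ge0// mulr_ge0// Re_norm_ge0.
move=> x; rewrite !fctE (le_trans (ler_normD _ _))// normrZ rmorphD rmorphM/=.
by rewrite -[(Normc.normc k)%:C]/(`|k|) mulrDl -mulrA lerD// ler_wpM2l.
Qed.

HB.instance Definition _ := GRing.isSubmodClosed.Build _ _
  bounded_operator bounded_operator_submod_closed.
HB.instance Definition _ := [SubChoice_isSubLmodule of bop by <:].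

Lemma bop_linear (f : bop) : linear f.
Proof. by have /bounded_operatorW[] := valP f. Qed.

HB.instance Definition _ (f : bop) :=
  GRing.isLinear.Build _ _ _ _ (bop_fun f) (bop_linear f).

Lemma bop_opnorm_fin (f : bop) : opnorm setT f \is a fin_num.
Proof.
by rewrite ge0_fin_numE ?opnorm_ge0//; have /set_mem[] := valP f.
Qed.

Definition bop_norm (f : bop) : R[i] := (fine (opnorm setT f))%:C.

Lemma bop_norm_ge (f : bop) x : `|f x| <= bop_norm f * `|x|.
Proof. by apply: opnormP; have /set_mem[] := valP f. Qed.

Lemma bop_norm_le (f : bop) (M : R) : 0 <= M ->
  (forall x, `|f x| <= M%:C * `|x|) -> bop_norm f <= M%:C.
Proof.
by move=> M0 fM; rewrite lecR -lee_fin fineK ?bop_opnorm_fin// opnorm_le.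
Qed.

Lemma bop_norm_ge0 (f : bop) : 0 <= bop_norm f.
Proof. by rewrite ler0c fine_ge0 ?opnorm_ge0. Qed.

Lemma bopP (f g : bop) : f =1 g -> f = g.
Proof. by move=> fg; apply/val_inj/funext. Qed.

Lemma bop_normD (f g : bop) : bop_norm (f + g) <= bop_norm f + bop_norm g.
Proof.
rewrite -rmorphD; apply: bop_norm_le => [|x].
  by rewrite -ler0c rmorphD addr_ge0 ?bop_norm_ge0.
rewrite /= rmorphD (le_trans (ler_normD _ _))// mulrDl.
by rewrite lerD ?bop_norm_ge.
Qed.

Lemma bop_normZ_le (k : R[i]) (f : bop) :
  bop_norm (k *: f) <= `|k| * bop_norm f.
Proof.
rewrite -(Re_normE k) -rmorphM; apply: bop_norm_le => [|x].
  by rewrite mulr_ge0 ?Re_norm_ge0// fine_ge0 ?opnorm_ge0.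
rewrite -[(k *: f) x]/(k *: f x).
rewrite normrZ rmorphM /= -[(Normc.normc k)%:C]/(`|k|) -mulrA ler_wpM2l//.
exact: bop_norm_ge.
Qed.

Lemma bop_norm0_eq0 (f : bop) : bop_norm f = 0 -> f = 0.
Proof.
move=> f0; apply: bopP => x /=; apply/eqP; rewrite -normr_le0.
by rewrite (le_trans (bop_norm_ge _ _))// f0 mul0r.
Qed.

Lemma bop_normZ (k : R[i]) (f : bop) : bop_norm (k *: f) = `|k| * bop_norm f.
Proof.
apply/eqP; rewrite eq_le bop_normZ_le/=.
have [->|k0] := eqVneq k 0; first by rewrite normr0 mul0r bop_norm_ge0.
rewrite -ler_pdivlMl ?normr_gt0// -normfV.
by rewrite (le_trans _ (bop_normZ_le _ _))// scalerA mulVf// scale1r.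
Qed.

HB.instance Definition _ :=
  Lmodule_isNormed.Build R[i] bop bop_normD bop_normZ bop_norm0_eq0.

End bounded_operators.
Arguments bounded_operator {R V W}.

Section endomorphisms.
Context {R : realType} (V : normedModType R[i]).
Implicit Types f g h : bop V V.

Lemma idfun_bounded_operator : (idfun : V -> V) \in bounded_operator.
Proof.
by apply: bounded_operatorP => //; exists 1 => // x; rewrite rmorph1 mul1r.
Qed.

Lemma comp_bounded_operator f g : f \o g \in bounded_operator.
Proof.
apply: bounded_operatorP => [k x y /=|]; first by rewrite !linearP.
have /bounded_operatorW[_ [M M0 fM]] := valP f.
have /bounded_operatorW[_ [N N0 gN]] := valP g.
exists (M * N) => [|x /=]; first exact: mulr_ge0.
have M0C : 0 <= M%:C :> R[i] by rewrite ler0c.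
rewrite (le_trans (fM _))// rmorphM -mulrA.
exact: ler_wpM2l (M0C) _ _ (gN x).
Qed.

Definition bop_one : bop V V := Bop idfun_bounded_operator.
Definition bop_mul f g : bop V V := Bop (comp_bounded_operator f g).

Lemma bop_mulA : associative bop_mul.
Proof. by move=> f g h; apply: bopP. Qed.
Lemma bop_mul1f : left_id bop_one bop_mul.
Proof. by move=> f; apply: bopP. Qed.
Lemma bop_mulf1 : right_id bop_one bop_mul.
Proof. by move=> f; apply: bopP. Qed.
Lemma bop_mulDl : left_distributive bop_mul +%R.
Proof. by move=> f g h; apply: bopP. Qed.
Lemma bop_mulDr : right_distributive bop_mul +%R.
Proof. by move=> f g h; apply: bopP => x /=; rewrite linearD. Qed.

(* The ring may be trivial (V = 0), hence the absence of an [algType]. *)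
HB.instance Definition _ := GRing.Zmodule_isPzRing.Build (bop V V)
  bop_mulA bop_mul1f bop_mulf1 bop_mulDl bop_mulDr.

End endomorphisms.

Notation "''B' ( H )" := (bop H H) (format "''B' ( H )") : type_scope.

Section operator_algebras.
Context {R : realType}.

(* Closed for the operator norm. *)
Definition unital_operator_algebra (H0 : hilbertType R) (A : set 'B(H0)) :=
  [/\ mulr_closed (mem A), submod_closed (mem A) & closed A].

(* A map from A to B(H) is encoded as a map on B(H0) that is only considered
   on A. *)
Definition unital_morphism (H0 H : hilbertType R) (A : set 'B(H0))
    (u : 'B(H0) -> 'B(H)) :=
  [/\ u 1 = 1,
      {in A &, {morph u : a b / a * b}},
      {in A &, {morph u : a b / a + b}} &
      forall k : R[i], {in A, {morph u : a / k *: a}}].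

Definition bounded_morphism (H0 H : hilbertType R) (A : set 'B(H0))
    (u : 'B(H0) -> 'B(H)) :=
  unital_morphism A u /\ (opnorm A u < +oo)%E.

Definition class_C (c : R) (H0 H : hilbertType R) (A : set 'B(H0))
    (u : 'B(H0) -> 'B(H)) :=
  unital_morphism A u /\ (opnorm A u <= c%:E)%E.

Definition similar_morphisms (H0 H1 H2 : hilbertType R) (A : set 'B(H0))
    (u1 : 'B(H0) -> 'B(H1)) (u2 : 'B(H0) -> 'B(H2)) :=
  exists (xi : bop H1 H2) (xi_inv : bop H2 H1),
    [/\ cancel xi xi_inv, cancel xi_inv xi &
        {in A, forall a, u2 a = xi \o u1 a \o xi_inv :> (H2 -> H2)}].

End operator_algebras.

(* Main.v *)
From HB Require Import structures.
Require Import Defs.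
From mathcomp Require Import all_boot all_order all_algebra.
From mathcomp Require Import complex.
From mathcomp Require Import all_classical all_reals all_analysis.
From mathcomp Require Import ring lra.
From mathcomp Require finmap.

Set Implicit Arguments.
Unset Strict Implicit.
Unset Printing Implicit Defensive.

Import Order.TTheory GRing.Theory Num.Theory.
Import Num.Def numFieldNormedType.Exports.

Local Open Scope classical_set_scope.
Local Open Scope ring_scope.
Local Open Scope complex_scope.

(** That the second property implies the first is clear, as a morphism of norm
    at most c is bounded.  For the converse, let u : A -> B(H) be bounded, of
    norm at most C.

    The proof works with squared Hilbertian seminorms ([hilbertian]): the
    nonnegative functions q on a complex vector space with
    q(k x) = |k|^2 q(x) that satisfy the parallelogram law.  They are stable
    under sums, pointwise limits, composition with linear maps and infima over
    the fibres of a linear surjection ([quotient_hilbertian]), and each of them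
    comes from an inner product (Jordan and von Neumann, [sesq]).  Let V be the
    free A-module on e_0, e_1, ... (the finitely supported sequences in A).
    For t >= 1, [forms t] is the set of those q on V with
    q(sum_m l_m e_m) <= sum_m |l_m|^2 and q(a x) <= t^2 |a|^2 q(x).  It is
    convex, and compact for pointwise convergence.

    Step 1.  Completing an element of [forms c] gives a Hilbert space on which
    A acts through a morphism of norm at most c.  The hypothesis makes this
    morphism similar to one of norm at most theta, so that every element of
    [forms c] is at most M times an element of [forms theta]
    ([forms_similarity]).  Since [forms c] contains the infinite convex
    combinations of its elements, the constant can be chosen uniformly, in the
    form of an inequality between sums over finite families of vectors
    ([forms_uniform]).

    Step 2.  Let w be in [forms C].  For q in [forms theta], the infimum of
      sum_m 1/2 (c/C)^(2m) w(y_m) + 1/2 (c/theta)^(2m) q(y_m)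
    over the finite sums x = sum_m y_m defines an element of [forms c]: acting
    by a and shifting the layers by one multiplies the sum by at most
    c^2 |a|^2 ([merged_forms]).  With Step 1 and a minimax theorem, a finite
    family of vectors on which every q in [forms theta] is at most 1 splits
    into layers for which this sum is bounded, simultaneously for all q
    ([decomposition]).  As theta < c, the layers of index at least d are small
    for all q in [forms theta] when d is large, while w is controlled on the
    layers of index less than d.  So the family is the sum of a part where w is
    bounded and of half of another such family, and w is bounded on it by a
    constant which depends only on theta, c, C and on the constant of Step 1
    ([unit_ball_bound]).  This argument needs to know in advance that w is
    bounded on these families; here the inclusion of A into B(H_0) enters,
    which provides the forms x |-> |x_m z|^2 in [forms theta].  By minimax
    again, w <= D q for some q in [forms theta] ([domination]).

    Step 3.  For orthonormal vectors T_0, ..., T_(N-1) of H, Step 2 applies to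
    w(x) = |sum_m u(x_m) T_m|^2.  The forms q obtained in this way induce forms
    on the formal sums of symbols (a, h) with a in A and h in H, and a
    compactness argument over the finite subsets of H produces one form Q there
    such that |sum u(a)h|^2 <= D Q ([formal_domination]).  The infimum of Q over
    the formal sums with a given value in H is the square of an equivalent
    Hilbertian norm on H for which u has norm at most theta ([renorming]).  The
    identity of H, from the old norm to the new one, is the required
    similarity. *)

(** * Squared Hilbertian seminorms and their inner products *)

Lemma addD_addB (V : zmodType) (x y : V) : x + y + (x - y) = x + x.
Proof. by rewrite addrACA subrr addr0. Qed.

Lemma addD_subB (V : zmodType) (x y : V) : x + y - (x - y) = y + y.
Proof. by rewrite opprB [x + y]addrC addD_addB. Qed.

Section hilbertian_forms.
Context {R : realType}.

Definition sqrmod (k : R[i]) : R := complex.Re k ^+ 2 + complex.Im k ^+ 2.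

Lemma sqrmodE (k : R[i]) : (sqrmod k)%:C = `|k| ^+ 2.
Proof.
by rewrite sqr_normc; case: k => a b; simpc; congr (_ +i* _); rewrite /sqrmod/=; ring.
Qed.

Lemma sqrmod_ge0 k : 0 <= sqrmod k.
Proof. by rewrite addr_ge0 ?sqr_ge0. Qed.

Lemma sqrmod_eq0 k : (sqrmod k == 0) = (k == 0).
Proof.
by rewrite -(inj_eq (@complexI _)) sqrmodE expf_eq0/= normr_eq0.
Qed.

Lemma sqrmodM k l : sqrmod (k * l) = sqrmod k * sqrmod l.
Proof. by apply: complexI; rewrite rmorphM/= !sqrmodE normrM exprMn. Qed.

Lemma sqrmodN k : sqrmod (- k) = sqrmod k.
Proof. by apply: complexI; rewrite !sqrmodE normrN. Qed.

Lemma sqrmod_conj k : sqrmod k^* = sqrmod k.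
Proof. by case: k => a b; rewrite /sqrmod/= sqrrN. Qed.

Lemma sqrmodC (t : R) : sqrmod t%:C = t ^+ 2.
Proof. by rewrite /sqrmod/= expr0n addr0. Qed.

Lemma sqrmod_i : sqrmod 'i = 1.
Proof. by rewrite /sqrmod/=; ring. Qed.

(** Two of the conditions are equalities in disguise ([hqZ], [hq_par]); the
    inequalities are what infima and limits produce directly. *)
Definition hilbertian (V : lmodType R[i]) (q : V -> R) :=
  [/\ forall x, 0 <= q x,
      forall k x, q (k *: x) <= sqrmod k * q x
    & forall x y, q (x + y) + q (x - y) <= 2 * q x + 2 * q y].

Variables (V : lmodType R[i]) (q : V -> R).
Hypothesis hq : hilbertian q.
Implicit Types (x y z : V) (s t : R).

Lemma hq_ge0 x : 0 <= q x. Proof. by case: hq. Qed.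

Lemma hqZ k x : q (k *: x) = sqrmod k * q x.
Proof.
case: (hq) => q_ge0 qZ _; apply/eqP; rewrite eq_le qZ/=.
have [->|k0] := eqVneq k 0; first by rewrite scale0r -(scale0r 0) /sqrmod/= expr0n addr0 mul0r.
rewrite -[x in sqrmod k * q x]scale1r -(mulVf k0) -scalerA.
apply: le_trans (ler_wpM2l (sqrmod_ge0 _) (qZ _ _)) _.
by rewrite mulrA -sqrmodM mulfV// (sqrmodC 1) expr1n mul1r.
Qed.

Lemma hqZr t x : q (t%:C *: x) = t ^+ 2 * q x. Proof. by rewrite hqZ sqrmodC. Qed.

Lemma hq0 : q 0 = 0.
Proof. by rewrite -(scale0r 0) (hqZr 0) expr0n mul0r. Qed.

Lemma hqN x : q (- x) = q x.
Proof. by rewrite -scaleN1r hqZ sqrmodN (sqrmodC 1) expr1n mul1r. Qed.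

Lemma hqB x y : q (x - y) = q (y - x). Proof. by rewrite -hqN opprB. Qed.

Lemma hq_double x : q (x + x) = 4 * q x.
Proof.
rewrite -{1 2}[x]scale1r -scalerDl -(rmorph1 (real_complex R)) -rmorphD hqZr.
by lra.
Qed.

(** The inequality applied to x + y and x - y is the reverse inequality. *)
Lemma hq_par x y : q (x + y) + q (x - y) = 2 * q x + 2 * q y.
Proof.
case: (hq) => _ _ par; apply/eqP; rewrite eq_le par/=.
have := par (x + y) (x - y).
by rewrite addD_addB addD_subB !hq_double; lra.
Qed.

Definition polar x y : R := (q (x + y) - q (x - y)) / 4.

Lemma polarC x y : polar x y = polar y x.
Proof. by rewrite /polar [x + y]addrC (hqB x). Qed.

Lemma polarxx x : polar x x = q x.
Proof.
by rewrite /polar subrr hq0 hq_double; lra.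
Qed.

Lemma polar0l y : polar 0 y = 0.
Proof. by rewrite /polar add0r sub0r hqN subrr mul0r. Qed.

(** The difference of the parallelogram laws for (x + y, z) and (x - y, z). *)
Lemma polarDB x z y : polar (x + z) y + polar (x - z) y = 2 * polar x y.
Proof.
rewrite /polar.
have := hq_par (x + y) z; have := hq_par (x - y) z.
rewrite (addrAC x y z) (addrAC x y (- z)) (addrAC x (- y) z) (addrAC x (- y) (- z)).
by lra.
Qed.

Lemma polarDl x z y : polar (x + z) y = polar x y + polar z y.
Proof.
pose h : R[i] := (2^-1)%:C.
have hh w : h *: w + h *: w = w.
  by rewrite -scalerDl -rmorphD/= -[2^-1]mul1r -splitr scale1r.
have half w : 2 * polar (h *: w) y = polar w y.
  by rewrite -(polarDB _ (h *: w)) subrr polar0l addr0 hh.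
have := polarDB (h *: (x + z)) (h *: (x - z)) y.
by rewrite half -scalerDr -scalerBr addD_addB addD_subB !scalerDr !hh => <-.
Qed.

Lemma polarNl x y : polar (- x) y = - polar x y.
Proof. by apply/eqP; rewrite -addr_eq0 -polarDl addNr polar0l. Qed.

Lemma polar_bound x y : `|polar x y| <= 2^-1 * (q x + q y).
Proof.
have := hq_par x y; have := hq_ge0 (x + y); have := hq_ge0 (x - y).
by rewrite ler_norml /polar => *; apply/andP; split; lra.
Qed.

Lemma polarMnl x y n : polar (x *+ n) y = n%:R * polar x y.
Proof.
elim: n => [|n IH]; first by rewrite mulr0n polar0l mul0r.
by rewrite mulrS polarDl IH -[n.+1]add1n natrD mulrDl mul1r.
Qed.

Lemma polarMzl x y (n : int) : polar (n%:~R *: x) y = n%:~R * polar x y.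
Proof.
case: n => n; first by rewrite -!pmulrn scaler_nat polarMnl.
by rewrite NegzE !rmorphN/= -!pmulrn scaleNr polarNl scaler_nat polarMnl mulNr.
Qed.

(** Additivity gives homogeneity for integers only.  The defect of homogeneity
    g is additive in the scalar and vanishes on integers, so its values are
    those on [0, 1), where it is bounded; a bounded additive function is 0. *)
Lemma polarZl t x y : polar (t%:C *: x) y = t * polar x y.
Proof.
pose g s := polar (s%:C *: x) y - s * polar x y.
have gD s s' : g (s + s') = g s + g s'.
  by rewrite /g rmorphD/= scalerDl polarDl; ring.
have gint (n : int) : g n%:~R = 0.
  by rewrite /g rmorph_int polarMzl subrr.
have gn s n : g (s *+ n) = g s *+ n.
  elim: n => [|n IH]; last by rewrite !mulrS gD IH.
  exact: (gint 0).
pose M := 2^-1 * (q x + q y) + `|polar x y|.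
have gM s : `|g s| <= M.
  rewrite -[s](subrK (Num.floor s)%:~R) gD gint addr0.
  have := ge_floor s; have := floorD1_gt s; rewrite intrD.
  set f := _%:~R => sf fs; have f01 : 0 <= s - f <= 1.
    by apply/andP; split; [rewrite subr_ge0|rewrite lerBlDr addrC ltW].
  rewrite (le_trans (ler_normB _ _))// lerD//.
    apply: le_trans (polar_bound _ _) _; rewrite ler_wpM2l// lerD2r hqZr.
    rewrite ler_piMl ?hq_ge0//; case/andP: f01 => ? ?.
    by rewrite exprn_ile1.
  rewrite normrM ler_piMl// ger0_norm; by case/andP: f01.
suff : g t = 0 by move/eqP; rewrite subr_eq0 => /eqP.
apply/eqP; rewrite -normr_le0 leNgt; apply/negP => g0.
have M0 : 0 <= M / `|g t| by rewrite divr_ge0// ?(le_trans _ (gM 0)).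
have := gM (t *+ (Num.bound (M / `|g t|))).
rewrite gn normrMn leNgt => /negP; apply.
by rewrite -mulr_natl -ltr_pdivrMr// archi_boundP.
Qed.

Lemma polarZr t x y : polar x (t%:C *: y) = t * polar x y.
Proof. by rewrite polarC polarZl polarC. Qed.

Lemma polarDr x y z : polar x (y + z) = polar x y + polar x z.
Proof. by rewrite polarC polarDl !(polarC x). Qed.

Lemma polarii x y : polar ('i *: x) ('i *: y) = polar x y.
Proof. by rewrite /polar -scalerDr -scalerBr !hqZ sqrmod_i !mul1r. Qed.

Lemma polaril x y : polar ('i *: x) y = - polar x ('i *: y).
Proof.
rewrite -polarii scalerA -expr2 sqr_i scaleN1r polarNl; congr (- _).
Qed.

Definition sesq x y : R[i] := polar x y +i* polar x ('i *: y).

Lemma complex_sum (k : R[i]) : k = (complex.Re k)%:C + 'i * (complex.Im k)%:C.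
Proof. by case: k => a b; simpc. Qed.

Lemma sesqDl x z y : sesq (x + z) y = sesq x y + sesq z y.
Proof. by rewrite /sesq !polarDl; simpc. Qed.

Lemma sesqZl k x y : sesq (k *: x) y = k * sesq x y.
Proof.
have polariil z : polar ('i *: z) ('i *: y) = polar z y by rewrite polarii.
rewrite /sesq {1 2}(complex_sum k) scalerDl -!scalerA !polarDl polariil polaril.
rewrite !polarZl; case: k => a b /=; simpc.
by congr (_ +i* _); rewrite addrC.
Qed.

Lemma sesqxx x : sesq x x = (q x)%:C.
Proof.
rewrite /sesq polarxx; congr (_ +i* _).
by have := polaril x x; rewrite polarC; lra.
Qed.

Lemma sesqC x y : sesq y x = (sesq x y)^*.
Proof. by rewrite /sesq polarC [polar y _]polarC polaril. Qed.

Lemma hqD x y : q (x + y) = q x + q y + 2 * polar x y.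
Proof. by rewrite -!polarxx !(polarDl, polarDr) (polarC y x); lra. Qed.

Lemma hqB2 x y : q (x - y) = q x + q y - 2 * polar x y.
Proof. by rewrite hqD hqN polarC polarNl polarC; lra. Qed.

(** From q(s x - y) >= 0. *)
Lemma hqD_le s x y : 0 < s -> q (x + y) <= (1 + s) * q x + (1 + s^-1) * q y.
Proof.
move=> s0; have := hq_ge0 (s%:C *: x - y).
rewrite hqD hqB2 polarZl hqZr => H.
suff : 2 * polar x y <= s * q x + s^-1 * q y by lra.
rewrite -(ler_pM2l s0) mulrDr [s * (s^-1 * _)]mulrA divff ?gt_eqF// mul1r.
by lra.
Qed.

Lemma hq_convex t x y : 0 <= t <= 1 ->
  q (t%:C *: x + (1 - t)%:C *: y) <= t * q x + (1 - t) * q y.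
Proof.
move=> /andP[t0 t1].
have := hq_ge0 (x - y); rewrite hqB2 hqD polarZl polarZr !hqZr => H.
have : 0 <= t * (1 - t) * (q x + q y - 2 * polar x y).
  by rewrite !mulr_ge0// subr_ge0.
by lra.
Qed.

(** As usual, from q(x - s S y) >= 0 where S is the inner product of x and y;
    the case q(y) = 0 needs another value of s. *)
Lemma sesq_CS x y : sqrmod (sesq x y) <= q x * q y.
Proof.
set S := sesq x y; set m := sqrmod S.
have key s : 0 <= q x + s ^+ 2 * m * q y - 2 * s * m.
  have := hq_ge0 (x + (- s%:C * S) *: y).
  rewrite hqD hqZ sqrmodM sqrmodN sqrmodC.
  have -> : polar x ((- s%:C * S) *: y) = - s * m; last by rewrite -/m; lra.
  rewrite -[LHS]/(complex.Re (sesq x ((- s%:C * S) *: y))) sesqC sesqZl.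
  rewrite (sesqC x y) /m /S /sqrmod.
  by case: (sesq x y) => a b; simpc; rewrite /=; ring.
have m0 : 0 <= m := sqrmod_ge0 _.
have [y0|y0] := eqVneq (q y) 0.
  rewrite y0 mulr0 leNgt; apply/negP => mp.
  have := key ((q x + 1) / m); rewrite y0 mulr0 addr0 -mulrA mulfVK ?gt_eqF//.
  by have := hq_ge0 x; lra.
have yp : 0 < q y by rewrite lt_neqAle eq_sym y0 hq_ge0.
have := key (q y)^-1; rewrite expr2 -!mulrA [m * q y]mulrC [_^-1 * (q y * m)]mulrA.
rewrite mulVf// mul1r => H.
rewrite -ler_pdivrMr// mulrC.
by lra.
Qed.

End hilbertian_forms.
(** * Hilbert spaces from definite complete forms *)

(** Completeness is phrased with the real-valued q itself, so that it can be
    stated before there is any norm or topology on V. *)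
Definition hq_complete (R : realType) (V : lmodType R[i]) (q : V -> R) :=
  forall F : set_system V, ProperFilter F ->
    (forall e, 0 < e -> exists x, F [set y | q (y - x) < e]) ->
    exists l, forall e, 0 < e -> F [set y | q (y - l) < e].

Record hilbert_data (R : realType) (V : lmodType R[i]) := HilbertData {
  hd_form :> V -> R;
  hd_hilbertian : hilbertian hd_form;
  hd_definite : forall x, hd_form x = 0 -> x = 0;
  hd_complete : hq_complete hd_form }.

Definition hilbert_of (R : realType) (V : lmodType R[i])
  (d : hilbert_data V) : Type := V.

Section hilbert_of.
Context {R : realType} (V : lmodType R[i]) (d : hilbert_data V).
Local Notation q := (hd_form d).
Local Notation T := (hilbert_of d).
Let hq : hilbertian q := hd_hilbertian d.

HB.instance Definition _ := GRing.Lmodule.on T.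

Definition hnorm (x : T) : R[i] := (Num.sqrt (q x))%:C.

Lemma sqr_hnorm x : hnorm x ^+ 2 = (q x)%:C.
Proof. by rewrite -rmorphXn/= sqr_sqrtr// hq_ge0. Qed.

Lemma hnormD x y : hnorm (x + y) <= hnorm x + hnorm y.
Proof.
rewrite -rmorphD lecR -(ler_pXn2r (ltn0Sn 1)) ?nnegrE ?addr_ge0 ?sqrtr_ge0//.
rewrite sqrrD !sqr_sqrtr ?hq_ge0// (hqD hq).
have : polar q x y <= Num.sqrt (q x) * Num.sqrt (q y).
  apply: le_trans (ler_norm _) _; rewrite -sqrtrM ?hq_ge0// -sqrtr_sqr.
  apply: ler_wsqrtr; apply: le_trans (sesq_CS hq x y).
  by rewrite /sqrmod/= lerDl sqr_ge0.
by rewrite mulr2n; lra.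
Qed.

Lemma hnormZ k x : hnorm (k *: x) = `|k| * hnorm x.
Proof.
rewrite -(Re_normE k) -rmorphM/=; congr (_%:C).
rewrite (hqZ hq) sqrtrM ?sqrmod_ge0//; congr (_ * _).
rewrite -[RHS]ger0_norm ?(Re_norm_ge0 k)// -sqrtr_sqr; congr Num.sqrt.
apply: complexI; rewrite sqrmodE rmorphXn/=.
by congr (_ ^+ 2); rewrite -[LHS](Re_normE k).
Qed.

Lemma hnorm0_eq0 x : hnorm x = 0 -> x = 0.
Proof.
move=> x0; apply: (hd_definite (h := d)); apply: complexI.
by rewrite -(sqr_hnorm x) x0 expr0n.
Qed.

HB.instance Definition _ :=
  Lmodule_isNormed.Build R[i] T hnormD hnormZ hnorm0_eq0.

Lemma hnorm_lt (x : T) (e : R) : 0 < e -> (`|x| < e%:C) = (q x < e ^+ 2).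
Proof.
move=> e0; rewrite -[`|x|]/(hnorm x) ltcR.
rewrite -(ltr_pXn2r (ltn0Sn 1)) ?nnegrE ?sqrtr_ge0 ?ltW//.
by rewrite sqr_sqrtr// hq_ge0.
Qed.

Lemma hilbert_of_complete (F : set_system T) :
  ProperFilter F -> cauchy F -> cvg F.
Proof.
move=> FF /cauchyP Fc.
have [e e0|l Fl] := @hd_complete _ _ d F.
  have e'0 : 0 < (Num.sqrt e)%:C :> R[i] by rewrite ltcR sqrtr_gt0.
  have [x Fx] := Fc _ e'0; exists x; apply: filterS Fx => y.
  rewrite -ball_normE/= distrC hnorm_lt ?sqrtr_gt0// sqr_sqrtr// ltW//.
apply/cvg_ex; exists l; apply/cvg_ballP => e e0.
have eE : e = (complex.Re e)%:C by rewrite RRe_real// gtr0_real.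
have e'0 : 0 < complex.Re e by rewrite -ltcR -eE.
apply: filterS (Fl _ (exprn_gt0 2 e'0)) => y /=.
by rewrite -ball_normE/= eE distrC hnorm_lt.
Qed.

HB.instance Definition _ := Uniform_isComplete.Build T hilbert_of_complete.

Lemma sesq_bilinear :
  bilinear_for *%R (conjC \; *%R) (sesq q : T -> T -> R[i]).
Proof.
have lin x : GRing.linear_for *%R ((sesq q)^~ x : T -> R[i]).
  by move=> k y z /=; rewrite (sesqDl hq) (sesqZl hq).
split=> // x k y z.
rewrite /= (sesqC hq (k *: y + z) x) (sesqC hq y x) (sesqC hq z x).
by rewrite (sesqDl hq) (sesqZl hq) rmorphD rmorphM.
Qed.

HB.instance Definition _ := @bilinear_isBilinear.Build R[i] T T R[i] *%R
  (conjC \; *%R) (sesq q : T -> T -> R[i]) sesq_bilinear.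

Lemma sesq_hermitian (x y : T) :
  sesq q x y = (-1) ^+ false * conjC (sesq q y x).
Proof. by rewrite expr0 mul1r (sesqC hq y x). Qed.

HB.instance Definition _ := @isHermitianSesquilinear.Build R[i] T false conjC
  (sesq q : T -> T -> R[i]) sesq_hermitian.

Lemma sesq_gt0 (x : T) : x != 0 -> 0 < (sesq q x x : R[i]).
Proof.
move=> x0; rewrite (sesqxx hq) ltcR lt_neqAle hq_ge0// andbT eq_sym.
by apply: contra x0 => /eqP/hd_definite ->.
Qed.

HB.instance Definition _ := @isDotProduct.Build R[i] T
  (sesq q : T -> T -> R[i]) sesq_gt0.

Lemma hnorm_inner (x : T) :
  `|x| ^+ 2 = ((sesq q : T -> T -> R[i]) : {dot T for conjC}) x x.
Proof. by rewrite [LHS]sqr_hnorm /= (sesqxx hq). Qed.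

HB.instance Definition _ :=
  CompleteNormedModule_isHilbert.Build R T hnorm_inner.

End hilbert_of.

(** * The dual of a Hilbertian seminorm *)

Lemma real_filter_limit (R : realType) (T : Type) (F : set_system T) (h : T -> R) :
  ProperFilter F ->
  (forall e, 0 < e -> exists f, F [set g | (h g - h f) ^+ 2 < e]) ->
  exists l, forall e, 0 < e -> F [set g | (h g - l) ^+ 2 < e].
Proof.
move=> FF Fc.
suff [l hl] : exists l : R, h @ F --> l.
  exists l => e e0; have se0 : 0 < Num.sqrt e by rewrite sqrtr_gt0.
  move/cvg_ballP : hl => /(_ _ se0); apply: filterS => g.
  rewrite -ball_normE/= distrC => gl.
  rewrite -[e]sqr_sqrtr ?(ltW e0)// -real_normK ?num_real//.
  by rewrite ltr_pXn2r// nnegrE// sqrtr_ge0.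
apply/cvg_ex; apply: R_complete; apply/cauchyP => e e0.
have [f Ff] := Fc _ (exprn_gt0 2 e0); exists (h f).
change (F [set g | ball (h f) e (h g)]).
apply: filterS Ff => g /=.
rewrite -ball_normE/= distrC -[(h g - h f) ^+ 2]real_normK ?num_real//.
by rewrite ltr_pXn2r ?nnegrE ?(ltW e0).
Qed.

Section dual.
Context {R : realType} (V : lmodType R[i]) (q : V -> R).

Definition dominated (f : V -> R[i]^o) (M : R) :=
  forall x, sqrmod (f x) <= M * q x.

Definition dual_functional : {pred V -> R[i]^o} :=
  mem [set f : V -> R[i]^o | linear f /\ exists2 M, 0 <= M & dominated f M].

Record dual := Dual { dual_fun :> V -> R[i]^o; _ : dual_fun \in dual_functional }.

HB.instance Definition _ := [isSub for dual_fun].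
HB.instance Definition _ := [Choice of dual by <:].

Lemma sqrmodD_le (k l : R[i]) : sqrmod (k + l) <= 2 * sqrmod k + 2 * sqrmod l.
Proof.
case: k l => a b [c d]; rewrite /sqrmod/=.
have := sqr_ge0 (a - c); have := sqr_ge0 (b - d); rewrite !sqrrB !sqrrD.
by rewrite !mulr2n; lra.
Qed.

Lemma dual_submod_closed : GRing.submod_closed dual_functional.
Proof.
split=> [|k f g /set_mem[lf [M M0 fM]] /set_mem[lg [N N0 gN]]].
  apply/mem_set; split=> [k x y|]; first by rewrite /= scaler0 addr0.
  by exists 0 => // x; rewrite mul0r /sqrmod/= expr0n addr0.
apply/mem_set; split=> [l x y|].
  rewrite !fctE lf lg !scalerDr addrACA; congr (_ + _ + _).
  by rewrite !scalerA mulrC.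
exists (2 * (sqrmod k * M) + 2 * N).
  by rewrite addr_ge0// !mulr_ge0 ?sqrmod_ge0.
move=> x; apply: le_trans (sqrmodD_le _ _) _.
rewrite -[(k *: f) x]/(k * f x : R[i]) sqrmodM.
have := ler_wpM2l (sqrmod_ge0 k) (fM x); have := gN x.
by move: (sqrmod (g x)) (sqrmod (f x)) => *; lra.
Qed.

HB.instance Definition _ := GRing.isSubmodClosed.Build _ _
  dual_functional dual_submod_closed.
HB.instance Definition _ := [SubChoice_isSubLmodule of dual by <:].

Hypothesis hq : hilbertian q.
Implicit Types f g : dual.

Lemma dual_linear (f : dual) : linear (f : V -> R[i]^o).
Proof. by have /set_mem[] := valP f. Qed.

HB.instance Definition _ (f : dual) :=
  GRing.isLinear.Build _ _ _ _ (dual_fun f) (dual_linear f).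

Lemma dual_ext (f g : dual) : f =1 g -> f = g.
Proof. by move=> fg; apply/val_inj/funext. Qed.

(** The squared dual norm is written as the Legendre conjugate of q: for this
    expression the parallelogram law of the dual follows from that of q by a
    change of variables.  [conjugateP] and [conjugate_le] identify it as the
    least M such that |f|^2 <= M q. *)
Definition conjugate_set (f : dual) : set R :=
  [set 2 * complex.Re (f x) - q x | x in [set: V]].
Definition conjugate (f : dual) : R := sup (conjugate_set f).

Lemma Re2_le_of_sqrmod (M s : R) (k : R[i]) : 0 <= M -> 0 <= s ->
  sqrmod k <= M * s -> 2 * complex.Re k - s <= M.
Proof.
move=> M0 s0 kMs; rewrite lerBlDr.
have r2 : complex.Re k ^+ 2 <= M * s.
  by apply: le_trans kMs; rewrite lerDl sqr_ge0.
rewrite leNgt; apply/negP => H.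
have := sqr_ge0 (M - s).
have : (M + s) ^+ 2 < (2 * complex.Re k) ^+ 2.
  by rewrite ltr_pXn2r// nnegrE ?addr_ge0// (le_trans _ (ltW H))// addr_ge0.
by rewrite sqrrB sqrrD exprMn !mulr2n => *; lra.
Qed.

Lemma conjugate_set_has_sup f : has_sup (conjugate_set f).
Proof.
split; first by exists (2 * complex.Re (f 0) - q 0); exists 0.
have /set_mem[_ [M M0 fM]] := valP f.
exists M => _ [x _ <-]; apply: Re2_le_of_sqrmod => //; exact: hq_ge0.
Qed.

Lemma conjugate_ge f x : 2 * complex.Re (f x) - q x <= conjugate f.
Proof. by apply: (ub_le_sup (conjugate_set_has_sup f).2); exists x. Qed.

Lemma conjugate_le_ub f M : (forall x, 2 * complex.Re (f x) - q x <= M) ->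
  conjugate f <= M.
Proof.
move=> fM; apply: ge_sup; first exact: (conjugate_set_has_sup f).1.
by move=> _ [x _ <-].
Qed.

Lemma conjugate_ge0 f : 0 <= conjugate f.
Proof. by have := conjugate_ge f 0; rewrite linear0/= (hq0 hq) mulr0 subr0. Qed.

Lemma conjugate_le f M : 0 <= M -> dominated f M -> conjugate f <= M.
Proof.
by move=> M0 fM; apply: conjugate_le_ub => x; apply: Re2_le_of_sqrmod => //; exact: hq_ge0.
Qed.

(** Optimize the inequality that defines the conjugate over the scalar
    multiples of x. *)
Lemma conjugateP f : dominated f (conjugate f).
Proof.
move=> x; set m := sqrmod _; set N := conjugate f.
have m0 : 0 <= m := sqrmod_ge0 _.
have key s : 2 * s * m - s ^+ 2 * m * q x <= N.
  have := conjugate_ge f ((s%:C * (f x)^*) *: x).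
  rewrite (hqZ hq) sqrmodM sqrmod_conj sqrmodC linearZ/=.
  have -> : complex.Re ((s%:C * (f x)^*) * f x) = s * m.
    by rewrite /m; case: (f x : R[i]) => a b; simpc; rewrite /sqrmod/=; ring.
  by rewrite mulrA.
have [x0|x0] := eqVneq (q x) 0.
  rewrite x0 mulr0; have /set_mem[_ [M M0 fM]] := valP f.
  by have := fM x; rewrite x0 mulr0.
have xp : 0 < q x by rewrite lt_neqAle eq_sym x0 hq_ge0.
rewrite -ler_pdivrMr//; have := key (q x)^-1.
rewrite expr2 -!mulrA [m * q x]mulrC [_^-1 * (q x * m)]mulrA mulVf// mul1r.
by rewrite [_^-1 * m]mulrC; lra.
Qed.

(** In the supremum over pairs (x, y) that defines the left-hand side of the
    parallelogram law, put s = x + y and t = x - y: it decouples. *)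
Lemma conjugate_hilbertian : hilbertian conjugate.
Proof.
split=> [|k f|f g]; first exact: conjugate_ge0.
  apply: conjugate_le; first by rewrite mulr_ge0 ?sqrmod_ge0 ?conjugate_ge0.
  move=> x; rewrite [sqrmod _]sqrmodM -mulrA ler_wpM2l ?sqrmod_ge0//.
  exact: conjugateP.
rewrite -lerBrDr; apply: conjugate_le_ub => x.
rewrite lerBrDr addrC -lerBrDr; apply: conjugate_le_ub => y.
have -> : complex.Re ((f + g) x) = complex.Re (f x) + complex.Re (g x).
  by rewrite -raddfD.
have -> : complex.Re ((f - g) y) = complex.Re (f y) - complex.Re (g y).
  by rewrite -raddfB.
have half (h : dual) z : complex.Re (h z) - 4^-1 * q z <= conjugate h.
  have := conjugate_ge h (2^-1%:C *: z); rewrite (hqZr hq) linearZ/=.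
  have -> : complex.Re (2^-1%:C *: h z) = 2^-1 * complex.Re (h z).
    by case: (h z : R[i]) => a b; simpc.
  by lra.
have := half f (x + y); have := half g (x - y); have := hq_par hq x y.
by rewrite linearB linearD raddfB raddfD/=; lra.
Qed.

Lemma conjugate_definite f : conjugate f = 0 -> f = 0.
Proof.
move=> f0; apply: dual_ext => x; have := conjugateP f x.
rewrite f0 mul0r => f_le0; apply/eqP; rewrite -sqrmod_eq0 eq_le f_le0.
exact: sqrmod_ge0.
Qed.

Lemma conjugateB f g : conjugate (f - g) = conjugate (g - f).
Proof. exact: (hqB conjugate_hilbertian). Qed.

(** The limit g is built pointwise.  That g is linear and that g - f0 is small
    are checked with elements of the filter that are close to g at the finitely
    many points concerned. *)
Lemma conjugate_complete : hq_complete conjugate.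
Proof.
move=> F FF Fc.
have ptw x : exists l : R[i], forall e, 0 < e ->
    F [set f : dual | sqrmod ((f x : R[i]) - l) < e].
  have Fx e : 0 < e ->
      exists f : dual, F [set g : dual | sqrmod ((g x : R[i]) - f x) < e].
    move=> e0; have qx := hq_ge0 hq x.
    have [|f Ff] := Fc (e / (q x + 1)); first by rewrite divr_gt0// ltr_wpDl.
    exists f; apply: filterS Ff => g /= gf.
    apply: le_lt_trans (conjugateP (g - f) x) _.
    apply: le_lt_trans (_ : _ <= e / (q x + 1) * q x) _.
      by rewrite ler_wpM2r// ltW.
    by rewrite -mulrA gtr_pMr// mulrC ltr_pdivrMr ?mul1r ?ltrDl// ltr_wpDl.
  have [a Ha] : exists a, forall e, 0 < e ->
      F [set g : dual | (complex.Re (g x) - a) ^+ 2 < e].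
    apply: (@real_filter_limit _ _ F (fun g : dual => complex.Re (g x))) => e /Fx[f Ff].
    exists f; apply: filterS Ff => g /=; apply: le_lt_trans.
    by rewrite -raddfB lerDl sqr_ge0.
  have [b Hb] : exists b, forall e, 0 < e ->
      F [set g : dual | (complex.Im (g x) - b) ^+ 2 < e].
    apply: (@real_filter_limit _ _ F (fun g : dual => complex.Im (g x))) => e /Fx[f Ff].
    exists f; apply: filterS Ff => g /=; apply: le_lt_trans.
    by rewrite -raddfB lerDr sqr_ge0.
  exists (a +i* b) => e e0; have e2 : 0 < e / 2 by rewrite divr_gt0.
  apply: filterS2 (Ha _ e2) (Hb _ e2) => g /= ga gb.
  by rewrite /sqrmod !raddfB/= [e]splitr ltrD.
have [g Hg] := choice ptw.
have approx e x y z : 0 < e -> exists f : dual,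
    [/\ sqrmod ((f x : R[i]) - g x) < e, sqrmod ((f y : R[i]) - g y) < e
      & sqrmod ((f z : R[i]) - g z) < e].
  move=> e0; apply: (@filter_ex _ F).
  by apply: filterS3 (Hg x _ e0) (Hg y _ e0) (Hg z _ e0) => f.
have small (k : R[i]) M : 0 <= M -> (forall e, 0 < e -> sqrmod k <= M * e) -> k = 0.
  move=> M0 H; apply/eqP; rewrite -sqrmod_eq0 eq_le sqrmod_ge0 andbT leNgt.
  apply/negP => k0; have M1 : 0 < M + 1 by rewrite ltr_wpDl.
  have := H _ (divr_gt0 k0 M1); have := divr_gt0 k0 M1.
  rewrite -[X in X <= _](divfK (lt0r_neq0 M1)).
  by move: (sqrmod k / (M + 1)) => t; lra.
have glin : linear (g : V -> R[i]^o).
  move=> k x y; apply/eqP; rewrite -subr_eq0; apply/eqP.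
  apply: (small _ (2 + 4 * sqrmod k + 4)) => [|e e0].
    by rewrite !addr_ge0// mulr_ge0// sqrmod_ge0.
  have [f [fx fy fz]] := approx e x y (k *: x + y) e0.
  have -> : g (k *: x + y) - (k *: (g x : R[i]^o) + g y) =
     - ((f (k *: x + y) : R[i]) - g (k *: x + y)) +
       (k * ((f x : R[i]) - g x) + ((f y : R[i]) - g y)).
    have sc (b c : R[i]) : b *: (c : R[i]^o) = b * c by [].
    rewrite (dual_linear f) !sc.
    have alg (a b a' b' w : R[i]) :
        w - (k * a + b) = - (k * a' + b' - w) + (k * (a' - a) + (b' - b)).
      by ring.
    exact: alg.
  apply: le_trans (sqrmodD_le _ _) _; rewrite sqrmodN.
  have := sqrmodD_le (k * ((f x : R[i]) - g x)) ((f y : R[i]) - g y).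
  rewrite sqrmodM.
  have := ler_wpM2l (sqrmod_ge0 k) (ltW fx).
  by move: fx fy fz => *; lra.
have gdom e (f0 : dual) : 0 < e -> F [set f | conjugate (f - f0) < e] ->
    forall x, sqrmod (g x - f0 x) <= 2 * e * q x.
  move=> e0 Ff x; rewrite leNgt; apply/negP => H.
  have d0 : 0 < (sqrmod (g x - f0 x) - 2 * e * q x) / 2.
    by rewrite divr_gt0// subr_gt0.
  have [f [fe fd]] : exists f : dual, conjugate (f - f0) < e /\
      sqrmod ((f x : R[i]) - g x) < (sqrmod (g x - f0 x) - 2 * e * q x) / 2.
    by apply: (@filter_ex _ F); apply: filterS2 Ff (Hg x _ d0) => f.
  have := sqrmodD_le (- ((f x : R[i]) - g x)) ((f x : R[i]) - f0 x).
  rewrite sqrmodN opprB subrKA.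
  have := conjugateP (f - f0) x.
  have := ler_wpM2r (hq_ge0 hq x) (ltW fe).
  rewrite -[(f - f0) x]/((f x : R[i]) - f0 x).
  by lra.
have gdual : (g : V -> R[i]^o) \in dual_functional.
  apply/mem_set; split=> //.
  have [f0 Ff0] := Fc 1 ltr01.
  exists (2 * 2 + 2 * conjugate f0).
    by rewrite addr_ge0// mulr_ge0// conjugate_ge0.
  move=> x; have := gdom 1 f0 ltr01 Ff0 x; have := conjugateP f0 x.
  have := sqrmodD_le (g x - f0 x) (f0 x); rewrite subrK.
  by lra.
exists (Dual gdual) => e e0; have e8 : 0 < e / 8 by rewrite divr_gt0.
have [f0 Ff0] := Fc _ e8; apply: filterS (Ff0) => f /= ff0.
have H : conjugate (f0 - Dual gdual) <= 2 * (e / 8).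
  rewrite conjugateB; apply: conjugate_le => [|x].
    by rewrite mulr_ge0// ltW.
  exact: gdom.
have [_ _ par] := conjugate_hilbertian.
have := par (f - f0) (f0 - Dual gdual); rewrite subrKA.
have := conjugate_ge0 (f - f0 - (f0 - Dual gdual)).
by lra.
Qed.

Definition dual_hilbert_data :=
  HilbertData conjugate_hilbertian conjugate_definite conjugate_complete.

End dual.

(** * Real-valued norms *)

Section realified_norm.
Context {R : realType}.

Lemma realcM (a b : R) : (a * b)%:C = a%:C * b%:C. Proof. exact: rmorphM. Qed.
Lemma realcD (a b : R) : (a + b)%:C = a%:C + b%:C. Proof. exact: rmorphD. Qed.
Lemma realcN (a : R) : (- a)%:C = - a%:C. Proof. exact: rmorphN. Qed.
Lemma realcX (a : R) n : (a ^+ n)%:C = a%:C ^+ n. Proof. exact: rmorphXn. Qed.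

Definition rnorm (X : normedModType R[i]) (x : X) : R := complex.Re `|x|.

Variable X : normedModType R[i].
Implicit Types x y : X.

Lemma rnormE x : (rnorm x)%:C = `|x|. Proof. exact: Re_normE. Qed.
Lemma rnorm_ge0 x : 0 <= rnorm x. Proof. exact: Re_norm_ge0. Qed.
Lemma rnormD x y : rnorm (x + y) <= rnorm x + rnorm y.
Proof. by rewrite -lecR realcD !rnormE ler_normD. Qed.
Lemma rnorm0 : rnorm (0 : X) = 0.
Proof. by apply: complexI; rewrite rnormE normr0. Qed.
Lemma rnormZ k x : rnorm (k *: x) ^+ 2 = sqrmod k * rnorm x ^+ 2.
Proof.
apply: complexI; rewrite realcX rnormE [RHS]realcM sqrmodE realcX rnormE.
by rewrite normrZ exprMn.
Qed.
Lemma rnorm_sum (I : Type) (r : seq I) (F : I -> X) :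
  rnorm (\sum_(m <- r) F m) <= \sum_(m <- r) rnorm (F m).
Proof.
elim: r => [|m r IH]; first by rewrite !big_nil rnorm0.
by rewrite !big_cons (le_trans (rnormD _ _))// lerD2l.
Qed.

Lemma rnorm_sqr_le (Y : normedModType R[i]) x (y : Y) (M : R) : 0 <= M ->
  `|x| <= M%:C * `|y| -> rnorm x ^+ 2 <= M ^+ 2 * rnorm y ^+ 2.
Proof.
move=> M0; rewrite -(rnormE x) -[`|y|]Re_normE -realcM lecR -exprMn => H.
by rewrite ler_pXn2r// ?nnegrE ?mulr_ge0 ?rnorm_ge0 ?Re_norm_ge0.
Qed.

Lemma norm_le_rnorm_sqr (Y : normedModType R[i]) x (y : Y) (M : R) : 0 <= M ->
  rnorm x ^+ 2 <= M ^+ 2 * rnorm y ^+ 2 -> `|x| <= M%:C * `|y|.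
Proof.
move=> M0; rewrite -exprMn ler_pXn2r ?nnegrE ?mulr_ge0 ?Re_norm_ge0// => xy.
by rewrite -(rnormE x) -[`|y|]Re_normE -realcM lecR.
Qed.

End realified_norm.

Lemma hilbertian_norm (R : realType) (H : hilbertType R) :
  hilbertian (fun x : H => rnorm x ^+ 2).
Proof.
have E (x : H) : (rnorm x ^+ 2)%:C = inner x x.
  by rewrite -normr_inner -[in RHS](rnormE x) realcX.
split=> [x|k x|x y]; first exact: sqr_ge0.
  by rewrite rnormZ.
rewrite -lecR !realcD (realcM 2 (rnorm x ^+ 2)) (realcM 2 (rnorm y ^+ 2)).
rewrite !E !(linearDl, linearDr, linearNl, linearNr)/=.
rewrite (_ : 2%:C = 2 :> R[i]) ?rmorph_nat// le_eqVlt; apply/orP; left.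
by apply/eqP; move: (inner x x) (inner x y) (inner y x) (inner y y) => *; ring.
Qed.

Lemma hilbertian_comp (R : realType) (X Y : lmodType R[i]) (f : X -> Y) (q : Y -> R) :
  linear f -> hilbertian q -> hilbertian (q \o f).
Proof.
move=> lf [q0 qZ qp]; pose lfT := GRing.isLinear.Build R[i] X Y *:%R f lf.
pose F : {linear X -> Y} := HB.pack f lfT.
have fZ k x : f (k *: x) = k *: f x by exact: (linearZ_LR F).
have fD x y : f (x + y) = f x + f y by exact: (linearD F).
have fB x y : f (x - y) = f x - f y by exact: (linearB F).
by split=> [x|k x|x y] /=; rewrite ?fZ ?fB ?fD.
Qed.

(** * The bidual as a functorial completion *)

(** The completion of (V, q) is realized inside its bidual: transposing twice
    extends an operator of V without any appeal to density. *)
Section transpose.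
Context {R : realType} (V : lmodType R[i]) (q : V -> R).

Record form_op := FormOp { form_op_fun :> V -> V; form_op_linear : linear form_op_fun;
  form_op_bound : exists2 M, 0 <= M & forall x, q (form_op_fun x) <= M * q x }.

Hypothesis hq : hilbertian q.
Implicit Types (T : form_op) (f : dual q).

Lemma transpose_subproof T f : (f \o T : V -> R[i]^o) \in dual_functional q.
Proof.
apply/mem_set; split=> [k x y|]; first by rewrite /= form_op_linear linearP.
have [M M0 TM] := form_op_bound T.
exists (conjugate f * M); first by rewrite mulr_ge0// conjugate_ge0.
move=> x; apply: le_trans (conjugateP hq f (T x)) _.
by rewrite -mulrA ler_wpM2l// conjugate_ge0.
Qed.

Definition transpose T f : dual q := Dual (transpose_subproof T f).

Lemma transpose_le T f M : 0 <= M -> (forall x, q (T x) <= M * q x) ->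
  conjugate (transpose T f) <= M * conjugate f.
Proof.
move=> M0 TM; apply: conjugate_le => //.
  by rewrite mulr_ge0// conjugate_ge0.
move=> x; apply: le_trans (conjugateP hq f (T x)) _.
by rewrite [M * _]mulrC -mulrA ler_wpM2l// conjugate_ge0.
Qed.

Lemma transpose_linear T : linear (transpose T).
Proof. by move=> k f g; apply: dual_ext. Qed.

End transpose.

Definition transpose_op (R : realType) (V : lmodType R[i]) (q : V -> R)
    (hq : hilbertian q) (T : form_op q) : form_op (conjugate (q := q)).
Proof.
refine (@FormOp _ _ _ (transpose hq T) (transpose_linear hq T) _).
have [M M0 TM] := form_op_bound T; exists M => // f; exact: transpose_le.
Defined.

Section bidual.
Context {R : realType} (V : lmodType R[i]) (q : V -> R) (hq : hilbertian q).

Let hq' := conjugate_hilbertian hq.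

Definition bidual : hilbertType R := hilbert_of (dual_hilbert_data hq').

Lemma sqr_bidual_norm (F : bidual) :
  `|F| ^+ 2 = (conjugate (F : dual (conjugate (q := q))))%:C.
Proof. exact: sqr_hnorm. Qed.

Lemma rnorm_bidual (F : bidual) :
  rnorm F ^+ 2 = conjugate (F : dual (conjugate (q := q))).
Proof.
by apply: complexI; rewrite -sqr_bidual_norm realcX rnormE.
Qed.

Definition bitranspose (T : form_op q) : bidual -> bidual :=
  transpose hq' (transpose_op hq T).

Lemma bitranspose_norm (T : form_op q) M (F : bidual) : 0 <= M ->
  (forall x, q (T x) <= M ^+ 2 * q x) -> `|bitranspose T F| <= M%:C * `|F|.
Proof.
move=> M0 TM; rewrite -(Re_normE F) -(Re_normE (bitranspose T F)) -rmorphM lecR.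
rewrite -(ler_pXn2r (ltn0Sn 1)) ?nnegrE ?mulr_ge0 ?Re_norm_ge0//.
rewrite exprMn !rnorm_bidual; apply: transpose_le; first exact: sqr_ge0.
by move=> f; apply: transpose_le => //; exact: sqr_ge0.
Qed.

Lemma bitranspose_bounded (T : form_op q) : bitranspose T \in bounded_operator.
Proof.
apply: bounded_operatorP; first exact: transpose_linear.
have [M M0 TM] := form_op_bound T; exists (Num.sqrt M); first exact: sqrtr_ge0.
move=> F; apply: bitranspose_norm; first exact: sqrtr_ge0.
by rewrite sqr_sqrtr.
Qed.

Definition bitranspose_bop (T : form_op q) : 'B(bidual) := Bop (bitranspose_bounded T).

Lemma evaluation_subproof x :
  ((fun f : dual q => f x) : dual q -> R[i]^o) \in dual_functional (conjugate (q := q)).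
Proof.
apply/mem_set; split=> [k f g //|].
exists (q x); first exact: hq_ge0.
by move=> f; rewrite mulrC; exact: conjugateP.
Qed.

Definition evaluation x : bidual := Dual (evaluation_subproof x).

Lemma evaluation_linear : linear evaluation.
Proof. by move=> k x y; apply: dual_ext => f; exact: dual_linear. Qed.

(** The functional that attains the norm of y. *)
Lemma representer_subproof y :
  ((fun x => sesq q x y) : V -> R[i]^o) \in dual_functional q.
Proof.
apply/mem_set; split=> [k x z|].
  by rewrite (sesqDl hq) (sesqZl hq).
exists (q y); first exact: hq_ge0.
by move=> x; rewrite mulrC; exact: sesq_CS.
Qed.

(** The embedding into the bidual is isometric: one inequality is the definition
    of the dual norm, the other one is the value at the functional represented
    by x. *)
Lemma evaluation_norm x : rnorm (evaluation x) ^+ 2 = q x.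
Proof.
rewrite rnorm_bidual; apply/eqP; rewrite eq_le; apply/andP; split.
  apply: conjugate_le => //; first exact: hq_ge0.
  by move=> f; rewrite [q x * _]mulrC; exact: (conjugateP hq f x).
pose f := Dual (representer_subproof x).
have := @conjugateP _ _ _ hq' (evaluation x) f.
have fx : conjugate f <= q x.
  apply: conjugate_le => //; first exact: hq_ge0.
  by move=> y; rewrite [q x * _]mulrC; exact: sesq_CS.
rewrite -[dual_fun _ f]/(sesq q x x) (sesqxx hq) sqrmodC => H.
have [->|x0] := eqVneq (q x) 0; first exact: conjugate_ge0.
have xp : 0 < q x by rewrite lt_neqAle eq_sym x0 hq_ge0.
rewrite -(ler_pM2r xp) -expr2; apply: le_trans H _.
by rewrite ler_wpM2l// conjugate_ge0.
Qed.

Lemma bitranspose_evaluation (T : form_op q) x :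
  bitranspose T (evaluation x) = evaluation (T x).
Proof. exact: dual_ext. Qed.

Lemma bitransposeM (S T U : form_op q) F : (forall x, U x = S (T x)) ->
  bitranspose U F = bitranspose S (bitranspose T F).
Proof.
move=> UST; apply: dual_ext => f /=; congr (dual_fun F).
by apply: dual_ext => x /=; rewrite UST.
Qed.

Lemma bitranspose1 (T : form_op q) F : (forall x, T x = x) -> bitranspose T F = F.
Proof.
move=> T1; apply: dual_ext => f /=; congr (dual_fun F).
by apply: dual_ext => x /=; rewrite T1.
Qed.

Lemma bitransposeD (S T U : form_op q) F : (forall x, U x = S x + T x) ->
  bitranspose U F = bitranspose S F + bitranspose T F.
Proof.
move=> UST; apply: dual_ext => f /=.
rewrite -[RHS]/((dual_fun F (transpose hq S f) : R[i]^o) +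
   dual_fun F (transpose hq T f)) -(linearD (F : dual _)).
by congr (dual_fun F); apply: dual_ext => x /=; rewrite UST linearD.
Qed.

Lemma bitransposeZ k (S U : form_op q) F : (forall x, U x = k *: S x) ->
  bitranspose U F = k *: bitranspose S F.
Proof.
move=> US; apply: dual_ext => f /=.
rewrite -[RHS]/(k *: (dual_fun F (transpose hq S f) : R[i]^o)).
rewrite -(linearZ_LR (F : dual _)).
by congr (dual_fun F); apply: dual_ext => x /=; rewrite US linearZ.
Qed.

End bidual.

(** * The algebra as a type, and the completion of a form *)

(** Bundling the hypothesis makes the elements of A into a ring and a module,
    to which canonical structures apply. *)
Record op_alg (R : realType) (H0 : hilbertType R) :=
  OpAlg { oa_set :> set 'B(H0); oa_unital : unital_operator_algebra oa_set }.

Section op_alg.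
Context {R : realType} {H0 : hilbertType R} (A : op_alg H0).

Definition oa_pred : {pred 'B(H0)} := mem (oa_set A).

Lemma oa_mulr : mulr_closed oa_pred. Proof. by have [] := oa_unital A. Qed.
Lemma oa_submod : GRing.submod_closed oa_pred. Proof. by have [] := oa_unital A. Qed.

Lemma oa_subring : subring_closed oa_pred.
Proof.
have [a1 aM] := oa_mulr; have [a0 aD] := oa_submod; split=> // a b aA bA.
by have := aD (-1) b a bA aA; rewrite scaleN1r addrC.
Qed.

HB.instance Definition _ := GRing.isSubmodClosed.Build _ _ oa_pred oa_submod.
HB.instance Definition _ := GRing.isSubringClosed.Build _ oa_pred oa_subring.

Record oa_elt := OaElt { oa_val :> 'B(H0); _ : oa_val \in oa_pred }.
HB.instance Definition _ := [isSub for oa_val].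
HB.instance Definition _ := [Choice of oa_elt by <:].
HB.instance Definition _ := [SubChoice_isSubLmodule of oa_elt by <:].
HB.instance Definition _ :=
  GRing.SubZmodule_isSubPzRing.Build 'B(H0) oa_pred oa_elt oa_subring.

Definition oa_norm (a : oa_elt) : R := rnorm (oa_val a).

Lemma oa_norm_ge0 a : 0 <= oa_norm a. Proof. exact: Re_norm_ge0. Qed.

Lemma oa_val1 : oa_val 1 = 1. Proof. by []. Qed.
Lemma oa_valM a b : oa_val (a * b) = oa_val a * oa_val b. Proof. by []. Qed.
Lemma oa_valD a b : oa_val (a + b) = oa_val a + oa_val b. Proof. by []. Qed.
Lemma oa_valZ k a : oa_val (k *: a) = k *: oa_val a. Proof. by []. Qed.
End op_alg.

Section morphisms.
Context {R : realType} {H0 : hilbertType R} (A : op_alg H0).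

Lemma insub_oa (a : oa_elt A) : insub (oa_val a) = Some a.
Proof. exact: valK. Qed.

Lemma oa_in (a : oa_elt A) : oa_val a \in oa_set A.
Proof. exact: valP a. Qed.

(** The norm of a morphism is a supremum over the unit ball of A only, hence the
    rescaling of a. *)
Lemma morphism_norm (H : hilbertType R) (u : 'B(H0) -> 'B(H)) (M : R) :
  0 <= M -> unital_morphism A u -> (opnorm A u <= M%:E)%E ->
  forall (a : oa_elt A) x, `|u (oa_val a) x| <= (M * oa_norm a)%:C * `|x|.
Proof.
move=> M0 [_ _ _ uZ] uM a x; set b := oa_val a.
apply: le_trans (bop_norm_ge _ _) _; rewrite ler_wpM2r//.
rewrite -[bop_norm (u b)]/(`|u b|) rmorphM/= -[(oa_norm a)%:C]/((complex.Re `|b|)%:C).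
rewrite Re_normE.
have [b0|b0] := eqVneq b 0.
  have -> : u b = 0; last by rewrite normr0 mulr_ge0// ler0c.
  by rewrite b0 -(scale0r 0) uZ ?scale0r// -b0 oa_in.
have nb : 0 < `|b| by rewrite normr_gt0.
rewrite -ler_pdivrMr// mulrC -[`|b|^-1]ger0_norm ?invr_ge0// -normrZ.
rewrite -(uZ _ _ (oa_in a)) -(Re_normE (u _)) lecR -lee_fin.
apply: le_trans uM; apply: ereal_sup_ubound; exists (`|b|^-1 *: b) => //; split=> /=.
  by have := oa_in (`|b|^-1 *: a); rewrite inE.
by rewrite normrZ normfV normr_id mulVf// gt_eqF.
Qed.

Definition similarity_property (c theta : R) :=
  forall (H : hilbertType R) (u : 'B(H0) -> 'B(H)), class_C c A u ->
    exists (H' : hilbertType R) (u' : 'B(H0) -> 'B(H')),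
      class_C theta A u' /\ similar_morphisms A u u'.

Variables (V : lmodType R[i]) (act : oa_elt A -> V -> V).
Hypotheses (act1 : forall x, act 1 x = x)
  (actM : forall a b x, act (a * b) x = act a (act b x))
  (actD : forall a b x, act (a + b) x = act a x + act b x)
  (actZ : forall k a x, act (k *: a) x = k *: act a x)
  (actPr : forall a, linear (act a)).

Definition act_bounded (c : R) (q : V -> R) :=
  forall a x, q (act a x) <= (c * oa_norm a) ^+ 2 * q x.

Section gns.
Variables (c : R) (q : V -> R).
Hypotheses (c0 : 0 <= c) (hq : hilbertian q) (qc : act_bounded c q).

Lemma act_op_bound a : exists2 M, 0 <= M & forall x, q (act a x) <= M * q x.
Proof. by exists ((c * oa_norm a) ^+ 2); [exact: sqr_ge0|exact: qc]. Qed.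

Definition act_op a : form_op q := FormOp (actPr a) (act_op_bound a).

Definition gns_morphism (a : 'B(H0)) : 'B(bidual hq) :=
  if insub a is Some a' then bitranspose_bop hq (act_op a') else 0.

Lemma gns_morphismE a : gns_morphism (oa_val a) = bitranspose_bop hq (act_op a).
Proof. by rewrite /gns_morphism insub_oa. Qed.

Lemma gns_unital : unital_morphism A gns_morphism.
Proof.
split.
- rewrite -(oa_val1 A) gns_morphismE; apply: bopP => F; exact: bitranspose1.
- move=> a b aA bA; rewrite -[a]/(oa_val (OaElt aA)) -[b]/(oa_val (OaElt bA)).
  rewrite -oa_valM !gns_morphismE; apply: bopP => F.
  by apply: bitransposeM => x /=; rewrite actM.
- move=> a b aA bA; rewrite -[a]/(oa_val (OaElt aA)) -[b]/(oa_val (OaElt bA)).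
  rewrite -oa_valD !gns_morphismE; apply: bopP => F.
  by apply: bitransposeD => x /=; rewrite actD.
- move=> k a aA; rewrite -[a]/(oa_val (OaElt aA)).
  rewrite -oa_valZ !gns_morphismE; apply: bopP => F.
  by apply: bitransposeZ => x /=; rewrite actZ.
Qed.

Lemma gns_class_C : class_C c A gns_morphism.
Proof.
split; first exact: gns_unital.
apply: ge_ereal_sup => _ [a [aA /= a1] <-]; rewrite lee_fin.
have {}aA : a \in oa_pred A by rewrite inE.
rewrite -lecR (Re_normE (gns_morphism a)) -[a]/(oa_val (OaElt aA)) gns_morphismE.
apply: bop_norm_le => // F; apply: bitranspose_norm => // x.
apply: le_trans (qc _ _) _; rewrite ler_wpM2r ?hq_ge0//.
rewrite ler_pXn2r ?nnegrE ?mulr_ge0 ?oa_norm_ge0//.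
by rewrite ler_piMr// -lecR Re_normE.
Qed.

End gns.

(** Pull the norm of the similar representation back along the embedding of V
    into the completion. *)
Lemma form_similarity c theta q : 0 <= c -> 0 <= theta ->
  similarity_property c theta -> hilbertian q -> act_bounded c q ->
  exists M q', [/\ 0 < M, hilbertian q', act_bounded theta q',
    forall x, q x <= M * q' x & forall x, q' x <= M * q x].
Proof.
move=> c0 t0 sim hq qc.
have [H' [u' [[u'm u't] [xi [eta [xiK etaK u'E]]]]]] := sim _ _ (gns_class_C c0 hq qc).
pose ev := evaluation hq.
have [lx [Mx Mx0 xiM]] := bounded_operatorW (valP xi).
have [ly [My My0 etaM]] := bounded_operatorW (valP eta).
have hn := hilbertian_norm H'.
exists (1 + Mx ^+ 2 + My ^+ 2), (fun x => rnorm (xi (ev x)) ^+ 2); split.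
- by rewrite !ltr_wpDr ?sqr_ge0.
- apply: (hilbertian_comp (f := fun x => xi (ev x)) _ hn) => k x y.
  by rewrite /ev evaluation_linear linearP.
- move=> a x.
  have -> : ev (act a x) = gns_morphism hq qc (oa_val a) (ev x).
    by rewrite gns_morphismE; exact: (esym (bitranspose_evaluation hq (act_op qc a) x)).
  have -> : xi (gns_morphism hq qc (oa_val a) (ev x)) = u' (oa_val a) (xi (ev x)).
    by rewrite u'E ?oa_in//= xiK.
  apply: rnorm_sqr_le; first by rewrite mulr_ge0// oa_norm_ge0.
  exact: morphism_norm.
- move=> x; rewrite -(evaluation_norm hq x) -/ev -{1}(xiK (ev x)).
  apply: le_trans (rnorm_sqr_le My0 (etaM _)) _.
  by rewrite ler_wpM2r ?sqr_ge0// lerDr addr_ge0 ?sqr_ge0.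
- move=> x; rewrite -(evaluation_norm hq x) -/ev.
  apply: le_trans (rnorm_sqr_le Mx0 (xiM _)) _.
  by rewrite ler_wpM2r ?sqr_ge0// addrAC lerDr addr_ge0 ?sqr_ge0.
Qed.
End morphisms.

(** * A minimax theorem *)

Section minimax.
Context {R : realType}.

(** Convexity of K, as seen by the functions f i only. *)
Definition convex_for (T I : Type) (K : set T) (f : I -> T -> R) :=
  forall p q s, K p -> K q -> 0 <= s <= 1 ->
    exists2 r, K r & forall i, f i r = s * f i p + (1 - s) * f i q.

(** If no p has both g p >= 0 and h p >= 0, then K is the union of the compact
    set K1 where g >= 0 > h, of the compact set K2 where h >= 0 > g and of the
    points where both are negative.  At p the combination
    s g p + (1 - s) h p vanishes for s = phi p; it is negative on K1 when
    s < phi p, and on K2 when s > phi p.  By convexity phi p2 < phi p1 for p1 in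
    K1 and p2 in K2, so that compactness leaves room for an s between the
    maximum of phi on K2 and its minimum on K1, and this s contradicts the
    hypothesis. *)
Lemma two_functions (T : topologicalType) (K : set T) (g h : T -> R) :
  compact K -> continuous g -> continuous h ->
  convex_for K (fun b : bool => if b then g else h) ->
  (forall s, 0 <= s <= 1 -> exists2 p, K p & 0 <= s * g p + (1 - s) * h p) ->
  exists p, [/\ K p, 0 <= g p & 0 <= h p].
Proof.
move=> cK cg ch Kconv H; apply: contrapT => /forallNP N.
have gh p : K p -> 0 <= g p -> h p < 0.
  by move=> Kp gp; rewrite ltNge; apply/negP => hp; exact: (N p).
have hg p : K p -> 0 <= h p -> g p < 0.
  by move=> Kp hp; rewrite ltNge; apply/negP => gp; exact: (N p).
have clo (f : T -> R) : continuous f -> closed [set p | 0 <= f p].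
  move=> cf; rewrite -[X in closed X]/(f @^-1` [set x | 0 <= x]).
  by apply: closed_comp; [move=> ? _; exact: cf|exact: closed_ge].
pose K1 := K `&` [set p | 0 <= g p]; pose K2 := K `&` [set p | 0 <= h p].
have cK1 : compact K1 by apply: compact_closedI => //; exact: clo.
have cK2 : compact K2 by apply: compact_closedI => //; exact: clo.
have K10 : K1 !=set0.
  have [|p Kp] := H 1; first by rewrite lexx ler01.
  by rewrite mul1r subrr mul0r addr0; exists p.
have K20 : K2 !=set0.
  have [|p Kp] := H 0; first by rewrite lexx ler01.
  by rewrite mul0r subr0 mul1r add0r; exists p.
pose phi p := h p / (h p - g p).
have cphi p : h p - g p != 0 -> {for p, continuous phi}.
  by move=> p0; apply: cvgM; [exact: ch|apply: cvgV => //; apply: cvgB; [exact: ch|exact: cg]].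
have [p1 /set_mem p1K p1min] : exists2 p, p \in K1 & forall t, t \in K1 -> phi p <= phi t.
  apply: compact_EVT_min => //; apply: continuous_in_subspaceT => t /set_mem[Kt gt].
  apply: cphi.
  by rewrite lt_eqF// subr_lt0 (lt_le_trans (gh _ Kt gt)).
have [p2 /set_mem p2K p2max] : exists2 p, p \in K2 & forall t, t \in K2 -> phi t <= phi p.
  apply: compact_EVT_max => //; apply: continuous_in_subspaceT => t /set_mem[Kt ht].
  apply: cphi.
  by rewrite gt_eqF// subr_gt0 (lt_le_trans (hg _ Kt ht)).
case: p1K => K1p /= g1; case: p2K => K2p /= h2.
have h1 := gh _ K1p g1; have g2 := hg _ K2p h2.
have lt12 : phi p2 < phi p1.
  (* the point of the segment from p2 to p1 where g vanishes *)
  have ad : 0 < g p1 - g p2 by lra.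
  have [|r Kr rE] := Kconv p1 p2 (- g p2 / (g p1 - g p2)) K1p K2p.
    by rewrite ler_pdivlMr// ler_pdivrMr//; apply/andP; split; lra.
  have c1 : 1 - - g p2 / (g p1 - g p2) = g p1 / (g p1 - g p2).
    by field; rewrite gt_eqF.
  have gr : g r = 0 by rewrite (rE true) c1; field; rewrite gt_eqF.
  have hr : h r < 0 by apply: gh => //; rewrite gr.
  have rE2 : h r * (g p1 - g p2) = - g p2 * h p1 + g p1 * h p2.
    by rewrite (rE false) c1; field; rewrite gt_eqF.
  have : h r * (g p1 - g p2) < 0 by rewrite nmulr_rlt0.
  rewrite rE2 /phi ltr_pdivrMr; last by lra.
  by rewrite mulrAC ltr_ndivlMr; lra.
pose s := (phi p1 + phi p2) / 2.
have sp1 : s < phi p1 by rewrite /s; lra.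
have sp2 : phi p2 < s by rewrite /s; lra.
have phi1 : phi p1 <= 1 by rewrite /phi ler_ndivrMr; lra.
have phi2 : 0 <= phi p2 by rewrite /phi divr_ge0//; lra.
have s01 : 0 <= s <= 1 by apply/andP; split; lra.
have [p Kp] := H s s01.
suff : s * g p + (1 - s) * h p < 0 by lra.
have [gp|gp] := leP 0 (g p).
  have hp := gh _ Kp gp; have := p1min p; rewrite inE => /(_ (conj Kp gp)).
  move/(lt_le_trans sp1); rewrite {1}/phi ltr_ndivlMr; lra.
have [hp|hp] := leP 0 (h p).
  have := p2max p; rewrite inE => /(_ (conj Kp hp)).
  move/le_lt_trans => /(_ _ sp2); rewrite {1}/phi ltr_pdivrMr; lra.
case/andP: s01 => s0 s1; have [->|s0'] := eqVneq s 0; first by lra.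
by rewrite ltr_wnDr ?mulr_ge0_le0 ?(ltW hp) ?subr_ge0// pmulr_rlt0// lt_neqAle eq_sym s0'.
Qed.

Lemma compact_finite_intersections (T : topologicalType) (I : Type) (K : set T)
    (C : I -> set T) : compact K -> (forall i, closed (C i)) ->
  (forall s : seq I, exists2 p, K p & forall i, List.In i s -> C i p) ->
  exists2 p, K p & forall i, C i p.
Proof.
move=> cK clC fin; have [r0 Kr0 _] := fin [::].
pose pT : ptopologicalType := HB.pack (Topological.sort T) (isPointed.Build T r0).
have := cK : @compact pT K; rewrite compact_In0.
move=> /(_ {classic I} setT (fun i => K `&` C i)) [].
- by exists C => // i _; exact: clC.
- move=> D _; have [p Kp pD] := fin (finmap.enum_fset D); exists p => i /= iD.
  split=> //=; apply: pD; have memIn (s : seq {classic I}) : i \in s -> List.In i s.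
    by elim: s => //= j s IH; rewrite inE => /orP[/eqP ->|/IH]; [left|right].
  exact: memIn.
move=> p pI; have [[i0]|nI] := pselect (inhabited I).
  by exists p => [|j]; [have [] := pI i0 Logic.I|have [] := pI j Logic.I].
by exists r0 => // i; case: nI; exact: inhabits.
Qed.

(** The functions are treated one at a time: by [two_functions], replacing K by
    its part where f i >= 0 preserves the hypotheses.  Compactness then handles
    all of them together. *)
Lemma minimax (T : topologicalType) (I : Type) (K : set T) (f : I -> T -> R) :
  K !=set0 -> compact K -> (forall i, continuous (f i)) -> convex_for K f ->
  (forall i j s, 0 <= s <= 1 ->
     exists k, forall p, K p -> f k p <= s * f i p + (1 - s) * f j p) ->
  (forall i, exists2 p, K p & 0 <= f i p) ->
  exists2 p, K p & forall i, 0 <= f i p.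
Proof.
move=> K0 cK cf Kconv Iconv H.
have clo i : closed [set p | 0 <= f i p].
  rewrite -[X in closed X]/(f i @^-1` [set x | 0 <= x]).
  by apply: closed_comp; [move=> ? _; exact: cf|exact: closed_ge].
have fin (s : seq I) : exists2 p, K p & forall i, List.In i s -> 0 <= f i p.
  have : forall L : set T, compact L -> convex_for L f -> L `<=` K ->
     (forall i, exists2 p, L p & 0 <= f i p) -> L !=set0 ->
     exists2 p, L p & forall i, List.In i s -> 0 <= f i p.
    elim: s => [|i s IH] L cL Lconv LK HL L0.
      by case: L0 => p Lp; exists p.
    have [|||||p [Lp pi] ps] := IH (L `&` [set p | 0 <= f i p]).
    - by apply: compact_closedI.
    - move=> p q t [Lp pi] [Lq qi] t01; have [r Lr rE] := Lconv p q t Lp Lq t01.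
      exists r => //; split => //=; rewrite rE; case/andP: t01 => t0 t1.
      by rewrite addr_ge0// mulr_ge0// subr_ge0.
    - by move=> p [Lp _]; exact: LK.
    - move=> j; have [|t t01|p [Lp pi pj]] := @two_functions T L (f i) (f j) cL (cf i) (cf j).
      + move=> p q t Lp Lq t01; have [r Lr rE] := Lconv p q t Lp Lq t01.
        by exists r => //; case.
      + have [k kE] := Iconv i j t t01; have [p Lp pk] := HL k.
        by exists p => //; apply: le_trans pk (kE _ (LK _ Lp)).
      by exists p.
    - by have [p Lp pi] := HL i; exists p.
    by exists p => // j [<-//|]; exact: ps.
  by apply.
exact: compact_finite_intersections.
Qed.

End minimax.

(** * Infima over the fibres of a linear map *)

(** The source X carries operations but no axioms: it will be a vector space, or
    the set of lists, where concatenation serves as an addition. *)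
Section quotient_form.
Context {R : realType} (X : Type) (W : lmodType R[i]).
Variables (addX subX : X -> X -> X) (sclX : R[i] -> X -> X).
Variables (p : X -> W) (Q : X -> R).
Hypotheses (pD : forall x y, p (addX x y) = p x + p y)
  (pB : forall x y, p (subX x y) = p x - p y)
  (pZ : forall k x, p (sclX k x) = k *: p x)
  (p_surj : forall w, exists x, p x = w).
Hypotheses (Q0 : forall x, 0 <= Q x)
  (QZ : forall k x, Q (sclX k x) <= sqrmod k * Q x)
  (Qpar : forall x y, Q (addX x y) + Q (subX x y) <= 2 * Q x + 2 * Q y).

Definition quotient_form (w : W) : R := inf [set Q x | x in [set x | p x = w]].

Lemma quotient_has_inf w : has_inf [set Q x | x in [set x | p x = w]].
Proof.
split; first by have [x xw] := p_surj w; exists (Q x), x.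
by exists 0 => _ [x _ <-].
Qed.

Lemma quotient_le x : quotient_form (p x) <= Q x.
Proof. by apply: ge_inf; [exact: (quotient_has_inf _).2|exists x]. Qed.

Lemma quotient_ge w M : (forall x, p x = w -> M <= Q x) -> M <= quotient_form w.
Proof.
move=> H; apply: lb_le_inf; first exact: (quotient_has_inf _).1.
by move=> _ [x xw <-]; exact: H.
Qed.

Lemma quotient_ge0 w : 0 <= quotient_form w.
Proof. exact: quotient_ge. Qed.

Lemma quotient_near w e : 0 < e -> exists2 x, p x = w & Q x < quotient_form w + e.
Proof.
by move=> e0; have [_ [x xw <-] Qx] := inf_adherent e0 (quotient_has_inf w); exists x.
Qed.

Lemma quotient_scale k w w' : 0 <= k ->
  (forall x, p x = w -> exists2 x', p x' = w' & Q x' <= k * Q x) ->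
  quotient_form w' <= k * quotient_form w.
Proof.
move=> k0 H; apply/ler_addgt0Pr => e e0.
have k1 : 0 < k + 1 by rewrite ltr_wpDl.
have [x xw Qx] := quotient_near w (divr_gt0 e0 k1).
have [x' <- Qx'] := H x xw.
apply: le_trans (quotient_le _) _; apply: le_trans Qx' _.
apply: le_trans (ler_wpM2l k0 (ltW Qx)) _.
rewrite mulrDr lerD2l mulrCA ger_pMr// ler_pdivrMr// mul1r; lra.
Qed.

(** The sum and difference of near minimizers over w and v compete in the infima
    over w + v and w - v. *)
Lemma quotient_hilbertian : hilbertian quotient_form.
Proof.
split=> [|k w|w v]; first exact: quotient_ge0.
  apply: quotient_scale; first exact: sqrmod_ge0.
  by move=> x <-; exists (sclX k x); [exact: pZ|exact: QZ].
apply/ler_addgt0Pr => e e0; have e4 : 0 < e / 4 by rewrite divr_gt0.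
have [x xw Qx] := quotient_near w e4; have [y yv Qy] := quotient_near v e4.
have := quotient_le (addX x y); have := quotient_le (subX x y).
by rewrite pD pB xw yv; have := Qpar x y; lra.
Qed.

End quotient_form.

(** * Finitely supported sequences *)

Section finite_sequences.
Context {R : realType} (W : lmodType R[i]).

Definition finite_support : {pred nat -> W} :=
  mem [set x : nat -> W | exists M, forall n, (M <= n)%N -> x n = 0].

Record fseq := FSeq { fs_fun :> nat -> W; _ : fs_fun \in finite_support }.
HB.instance Definition _ := [isSub for fs_fun].
HB.instance Definition _ := [Choice of fseq by <:].

Lemma finite_support_submod_closed : GRing.submod_closed finite_support.
Proof.
split=> [|k x y /set_mem[M xM] /set_mem[N yN]]; first by apply/mem_set; exists 0%N.
apply/mem_set; exists (maxn M N) => n; rewrite geq_max => /andP[Mn Nn].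
by rewrite !fctE xM// yN// scaler0 addr0.
Qed.

HB.instance Definition _ := GRing.isSubmodClosed.Build _ _
  finite_support finite_support_submod_closed.
HB.instance Definition _ := [SubChoice_isSubLmodule of fseq by <:].

Lemma fs_ext (x y : fseq) : x =1 y -> x = y.
Proof. by move=> xy; apply/val_inj/funext. Qed.

Lemma fsD (x y : fseq) n : (x + y) n = x n + y n. Proof. by []. Qed.
Lemma fsB (x y : fseq) n : (x - y) n = x n - y n. Proof. by []. Qed.
Lemma fsZ k (x : fseq) n : (k *: x) n = k *: x n. Proof. by []. Qed.
Lemma fs0 n : (0 : fseq) n = 0. Proof. by []. Qed.

Lemma fs_supp (x : fseq) : exists M, forall n, (M <= n)%N -> x n = 0.
Proof. by have /set_mem := valP x. Qed.

Definition fs_len (x : fseq) : nat := sval (cid (fs_supp x)).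

Lemma fs_lenP (x : fseq) n : (fs_len x <= n)%N -> x n = 0.
Proof. by rewrite /fs_len; case: cid => M /= H; exact: H. Qed.

Lemma single_subproof m (w : W) : (fun n => if n == m then w else 0) \in finite_support.
Proof.
apply/mem_set; exists m.+1 => n mn; case: eqP => // nm.
by rewrite nm ltnn in mn.
Qed.

Definition single m w : fseq := FSeq (single_subproof m w).

(** The sum runs over any range that contains the support ([fsum_widen]);
    [fs_len] chooses one. *)
Definition fsum (U : nmodType) (F : nat -> W -> U) (x : fseq) : U :=
  \sum_(0 <= m < fs_len x) F m (x m).

Lemma fsum_widen (U : nmodType) (F : nat -> W -> U) (x : fseq) M :
  (forall m, F m 0 = 0) -> (forall n, (M <= n)%N -> x n = 0) ->
  fsum F x = \sum_(0 <= m < M) F m (x m).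
Proof.
move=> F0 xM.
have tail a b : (a <= b)%N -> (forall n, (a <= n)%N -> x n = 0) ->
    \sum_(0 <= m < b) F m (x m) = \sum_(0 <= m < a) F m (x m).
  move=> ab xa; rewrite (big_cat_nat _ ab)//=.
  suff -> : \sum_(a <= m < b) F m (x m) = 0 by rewrite addr0.
  by rewrite big_nat big1// => m /andP[am _]; rewrite xa.
have lx n : (fs_len x <= n)%N -> x n = 0 by exact: fs_lenP.
by rewrite /fsum; have [h|/ltnW h] := leqP (fs_len x) M; rewrite (tail _ _ h).
Qed.

Lemma fs_common (x y : fseq) :
  exists M, forall n, (M <= n)%N -> x n = 0 /\ y n = 0.
Proof.
exists (maxn (fs_len x) (fs_len y)) => n.
by rewrite geq_max => /andP[? ?]; split; exact: fs_lenP.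
Qed.

Lemma fsumP (U : lmodType R[i]) (F : nat -> {linear W -> U}) : linear (fsum F).
Proof.
move=> k x y; have [M xyM] := fs_common x y.
have F0 m : F m 0 = 0 by exact: linear0.
rewrite !(@fsum_widen _ F _ M)// => [|n /xyM[]//|n /xyM[]//|n /xyM[xn yn]].
  by rewrite scaler_sumr -big_split; apply: eq_bigr => m _; rewrite linearP.
by rewrite fsD fsZ xn yn scaler0 addr0.
Qed.

Lemma fsum_single (U : nmodType) (F : nat -> W -> U) m w :
  (forall m, F m 0 = 0) -> fsum F (single m w) = F m w.
Proof.
move=> F0; rewrite (@fsum_widen _ F _ m.+1)//; last first.
  by move=> n mn /=; case: eqP => // nm; rewrite nm ltnn in mn.
rewrite big_nat_recr//= eqxx big_nat big1 ?add0r// => n /andP[_ nm].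
by rewrite ltn_eqF.
Qed.

Lemma fsum_hilbertian (F : nat -> W -> R) : (forall m, hilbertian (F m)) ->
  hilbertian (fsum F).
Proof.
move=> hF; have F0 m : F m 0 = 0 by apply: hq0.
split=> [x|k x|x y].
- by rewrite sumr_ge0// => m _; exact: hq_ge0.
- have [M xM] := fs_supp x.
  rewrite !(@fsum_widen _ F _ M)// => [|n /xM xn]; last by rewrite fsZ xn scaler0.
  by rewrite mulr_sumr ler_sum// => m _; have [_ + _] := hF m; exact.
have [M xyM] := fs_common x y.
rewrite !(@fsum_widen _ F _ M)//.
- by rewrite -big_split !mulr_sumr -big_split ler_sum// => m _; have [_ _] := hF m; exact.
- by move=> n /xyM[].
- by move=> n /xyM[].
- by move=> n /xyM[xn yn]; rewrite fsB xn yn subr0.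
- by move=> n /xyM[xn yn]; rewrite fsD xn yn addr0.
Qed.

End finite_sequences.

(** * Compactness for pointwise convergence *)

Section pointwise_compactness.
Context {R : realType} (X : eqType).
Local Notation T := {ptws X -> R}.

Lemma ptws_eval_continuous (x : X) : continuous (fun q : T => q x : R).
Proof. exact: (@proj_continuous _ (fun _ : X => R) x). Qed.

Lemma closed_ineq (J : Type) (F G : J -> T -> R) :
  (forall j, continuous (F j)) -> (forall j, continuous (G j)) ->
  closed [set q : T | forall j, F j q <= G j q].
Proof.
move=> cF cG; rewrite (_ : [set _ | _] = \bigcap_j [set q | F j q <= G j q]).
  apply: closed_bigI => j _.
  rewrite (_ : [set _ | _] = (fun q => G j q - F j q) @^-1` [set x | 0 <= x]).
    apply: closed_comp; last exact: closed_ge.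
    by move=> q _; exact: (cvgB (cG j q) (cF j q)).
  by apply/seteqP; split=> q /=; rewrite subr_ge0.
by apply/seteqP; split=> q; [move=> H j _; exact: H|move=> H j; exact: H].
Qed.

Lemma compact_pointwise (K : set T) : closed K ->
  (forall x, exists B, forall q, K q -> 0 <= q x <= B) -> compact K.
Proof.
move=> Kcl /choice[B KB].
apply: (subclosed_compact Kcl (@tychonoff X (fun _ => R) (fun x => `[0, B x]%classic) _)).
  by move=> x; exact: segment_compact.
by move=> q Kq x /=; rewrite in_itv/=; exact: KB.
Qed.

(** A cluster point of the sequence bounds it from above. *)
Lemma compact_monotone (K : set T) (S : nat -> T) :
  compact K -> (forall n, K (S n)) -> (forall n x, S n x <= S n.+1 x) ->
  exists2 p, K p & forall n x, S n x <= p x.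
Proof.
move=> cK KS Sn.
have mono n m x : (n <= m)%N -> S n x <= S m x.
  by move/subnK => <-; elim: (m - n)%N => // k IH; rewrite addSn (le_trans IH).
have [|p [Kp clp]] := cK (S @ \oo); first by exists 0%N => // n _; exact: KS.
exists p => // n x; have : closure [set q : T | S n x <= q x] p.
  move=> U Up; apply: clp => //; exists n => // m /= nm; exact: mono.
have cl : closed [set q : T | S n x <= q x].
  have := @closed_ineq unit (fun _ _ => S n x) (fun _ q => q x).
  rewrite (_ : [set _ | _] = [set q : T | S n x <= q x]).
    by apply=> _; [exact: cst_continuous|exact: ptws_eval_continuous].
  by apply/seteqP; split=> q; [move/(_ tt)|move=> H _].
by rewrite -(closure_id _).1.
Qed.
End pointwise_compactness.

(** * The forms of bound t on the free module *)

Section sequences_over_algebra.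
Context {R : realType} {H0 : hilbertType R} (A : op_alg H0).
Local Notation E := (oa_elt A).
Local Notation V := (fseq E).

Lemma fs_act_subproof (a : E) (x : V) :
  (fun n => a * x n : E) \in @finite_support R E.
Proof.
by have [M xM] := fs_supp x; apply/mem_set; exists M => n /xM ->; rewrite mulr0.
Qed.

Definition fs_act (a : E) (x : V) : V := FSeq (fs_act_subproof a x).

Lemma oa_ext (a b : E) : oa_val a = oa_val b -> a = b. Proof. exact: val_inj. Qed.

Lemma fs_act1 x : fs_act 1 x = x.
Proof. by apply: fs_ext => n /=; rewrite mul1r. Qed.
Lemma fs_actM a b x : fs_act (a * b) x = fs_act a (fs_act b x).
Proof. by apply: fs_ext => n /=; rewrite mulrA. Qed.
Lemma fs_actD a b x : fs_act (a + b) x = fs_act a x + fs_act b x.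
Proof. by apply: fs_ext => n; rewrite fsD /= mulrDl. Qed.
Lemma oa_scalerAl k (a b : E) : (k *: a) * b = k *: (a * b).
Proof. exact: oa_ext (bopP _). Qed.
Lemma oa_scalerAr k (a b : E) : a * (k *: b) = k *: (a * b).
Proof. by apply: oa_ext; apply: bopP => x; exact: (linearZ_LR (oa_val a) k (oa_val b x)). Qed.
Lemma fs_actZ k a x : fs_act (k *: a) x = k *: fs_act a x.
Proof. by apply: fs_ext => n; rewrite fsZ /= oa_scalerAl. Qed.
Lemma fs_act_linear a : linear (fs_act a).
Proof. by move=> k x y; apply: fs_ext => n; rewrite !(fsD, fsZ) /= mulrDr oa_scalerAr. Qed.

Lemma fs_act0 (a : E) : fs_act a 0 = 0.
Proof. by apply: fs_ext => k /=; rewrite mulr0. Qed.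

Lemma fs_act_sum (a : E) (I : Type) (r : seq I) (F : I -> V) :
  fs_act a (\sum_(m <- r) F m) = \sum_(m <- r) fs_act a (F m).
Proof.
elim: r => [|m r IH]; first by rewrite !big_nil fs_act0.
by rewrite !big_cons -[F m]scale1r fs_act_linear IH !scale1r.
Qed.

Lemma fs_act_scale (a : E) k x : fs_act a (k *: x) = k *: fs_act a x.
Proof. by have := fs_act_linear a k x 0; rewrite fs_act0 !addr0. Qed.

Definition unit_vector n : V := single n (1 : E).
Local Notation e_ := unit_vector.

Definition normalized (q : V -> R) := forall N (l : nat -> R[i]),
  q (\sum_(0 <= m < N) l m *: e_ m) <= \sum_(0 <= m < N) sqrmod (l m).

(** The elements of [forms t] are the functions |sum_m v(x_m) z_m|^2 of x, where
    v is a morphism of norm at most t and the z_m are the images of an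
    orthonormal family by a contraction. *)
Definition forms (t : R) : set {ptws V -> R} :=
  [set q | [/\ hilbertian q, normalized q & act_bounded fs_act t q]].

Lemma normalized_unit q n : normalized q -> q (e_ n) <= 1.
Proof.
move=> /(_ n.+1 (fun m => if m == n then 1 else 0)).
rewrite !big_nat_recr//= eqxx scale1r.
rewrite big_nat big1 => [|m /andP[_ mn]]; last by rewrite ltn_eqF// scale0r.
rewrite big_nat big1 => [|m /andP[_ mn]]; last by rewrite ltn_eqF// /sqrmod/= expr0n addr0.
by rewrite !add0r (sqrmodC 1) expr1n.
Qed.

Lemma fs_sumE N (F : nat -> V) n : (\sum_(0 <= m < N) F m) n = \sum_(0 <= m < N) F m n.
Proof. by elim/big_ind2 : _ => // x a y b <- <-. Qed.

Lemma fs_decomposition (x : V) :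
  x = \sum_(0 <= m < fs_len x) fs_act (x m) (e_ m).
Proof.
apply: fs_ext => n; rewrite fs_sumE.
have E0 m : n != m -> fs_act (x m) (e_ m) n = 0.
  by move=> nm /=; rewrite (negPf nm) mulr0.
have [nx|xn] := ltnP n (fs_len x).
  rewrite (bigD1_seq n)/= ?mem_index_iota ?iota_uniq// big1; last first.
    by move=> m; rewrite eq_sym => /E0.
  by rewrite eqxx mulr1 addr0.
rewrite fs_lenP// big_nat big1// => m /andP[_ mx].
by apply: E0; rewrite gtn_eqF// (leq_trans mx).
Qed.

(** A finitely supported sequence is a finite sum of vectors a e_m, where
    q(a e_m) <= (t |a|)^2. *)
Lemma forms_bounded t x : exists B, forall q, forms t q -> 0 <= q x <= B.
Proof.
rewrite (fs_decomposition x); elim: (fs_len x) => [|M [B IH]].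
  exists 0 => q [hq _ _]; rewrite big_nil; apply/andP; split; first exact: hq_ge0.
  by rewrite (hq0 hq).
exists (2 * B + 2 * (t * oa_norm (x M)) ^+ 2) => q fq; have [hq nq tq] := fq.
apply/andP; split; first exact: hq_ge0.
rewrite big_nat_recr//=; have := IH q fq; have [_ _ par] := hq.
have := par (\sum_(0 <= m < M) fs_act (x m) (e_ m)) (fs_act (x M) (e_ M)).
have := hq_ge0 hq (\sum_(0 <= m < M) fs_act (x m) (e_ m) - fs_act (x M) (e_ M)).
have := tq (x M) (e_ M); have := normalized_unit M nq.
have := sqr_ge0 (t * oa_norm (x M)).
move: (_ ^+ 2) => T T0 e1 qe q0 qp /andP[_ qB].
have : T * q (e_ M) <= T by rewrite ler_piMr.
by lra.
Qed.

Lemma forms_closed t : closed (forms t).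
Proof.
have ev := @ptws_eval_continuous R V.
rewrite (_ : forms t = [set q : {ptws V -> R} | forall x, 0 <= q x] `&`
  ([set q : {ptws V -> R} | forall kx : R[i] * V,
     q (kx.1 *: kx.2) <= sqrmod kx.1 * q kx.2] `&`
  ([set q : {ptws V -> R} | forall xy : V * V,
     q (xy.1 + xy.2) + q (xy.1 - xy.2) <= 2 * q xy.1 + 2 * q xy.2] `&`
  ([set q : {ptws V -> R} | forall Nl : nat * (nat -> R[i]),
     q (\sum_(0 <= m < Nl.1) Nl.2 m *: e_ m) <= \sum_(0 <= m < Nl.1) sqrmod (Nl.2 m)] `&`
   [set q : {ptws V -> R} | forall ax : E * V,
     q (fs_act ax.1 ax.2) <= (t * oa_norm ax.1) ^+ 2 * q ax.2])))).
  have cM k x : continuous (fun q : {ptws V -> R} => k * q x).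
    by move=> q; exact: (cvgM (cvg_cst k) (ev x q)).
  do 4?[apply: closedI]; apply: closed_ineq => j;
    try exact: cst_continuous; try exact: ev; try exact: cM.
    by move=> q; exact: (cvgD (ev _ q) (ev _ q)).
  by move=> q; exact: (cvgD (cM _ _ q) (cM _ _ q)).
apply/seteqP; split=> q.
  move=> [[q0 qZ qp] qn qa]; do ?split; first exact: q0.
  - by case=> *; exact: qZ.
  - by case=> *; exact: qp.
  - by case=> *; exact: qn.
  - by case=> *; exact: qa.
move=> [q0 [qZ [qp [qn qa]]]]; split; first split.
- exact: q0.
- by move=> k x; exact: (qZ (k, x)).
- by move=> x y; exact: (qp (x, y)).
- by move=> N l; exact: (qn (N, l)).
- by move=> a x; exact: (qa (a, x)).
Qed.

Lemma forms_compact t : compact (forms t).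
Proof. by apply: compact_pointwise; [exact: forms_closed|exact: forms_bounded]. Qed.

End sequences_over_algebra.

(** * The uniform constant *)

Section forms_operations.
Context {R : realType} {H0 : hilbertType R} (A : op_alg H0).
Local Notation E := (oa_elt A).
Local Notation V := (fseq E).
Local Notation forms := (@forms R H0 A).

Lemma hilbertian_comb (X : lmodType R[i]) (p q : X -> R) a b : 0 <= a -> 0 <= b ->
  hilbertian p -> hilbertian q -> hilbertian (fun x => a * p x + b * q x).
Proof.
move=> a0 b0 [p0 pZ pp] [q0 qZ qp]; split=> [x|k x|x y].
- by rewrite addr_ge0// mulr_ge0.
- by have := ler_wpM2l a0 (pZ k x); have := ler_wpM2l b0 (qZ k x); lra.
- by have := ler_wpM2l a0 (pp x y); have := ler_wpM2l b0 (qp x y); lra.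
Qed.

Lemma forms_comb t (p q : V -> R) a b : 0 <= a -> 0 <= b -> a + b <= 1 ->
  forms t p -> forms t q -> forms t (fun x => a * p x + b * q x).
Proof.
move=> a0 b0 ab [hp np tp] [hq nq tq]; split; first exact: hilbertian_comb.
  move=> N l; have := ler_wpM2l a0 (np N l); have := ler_wpM2l b0 (nq N l).
  set S := \sum_(0 <= m < N) sqrmod (l m).
  have : 0 <= S by rewrite sumr_ge0// => m _; exact: sqrmod_ge0.
  by move=> S0; have : (a + b) * S <= S by [rewrite ler_piMl]; lra.
move=> e x; have := ler_wpM2l a0 (tp e x); have := ler_wpM2l b0 (tq e x).
by move: (_ ^+ 2) => T; lra.
Qed.

Lemma forms_convex t (p q : V -> R) s : 0 <= s <= 1 ->
  forms t p -> forms t q -> forms t (fun x => s * p x + (1 - s) * q x).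
Proof. by move=> /andP[s0 s1]; apply: forms_comb; lra. Qed.

Lemma forms_zero t : forms t (fun _ => 0).
Proof.
split; first by split=> *; rewrite ?mulr0 ?addr0.
  by move=> N l; rewrite sumr_ge0// => m _; exact: sqrmod_ge0.
by move=> a x; rewrite mulr0.
Qed.

Lemma forms_sum t (q : nat -> V -> R) (a : nat -> R) N : (forall m, 0 <= a m) ->
  \sum_(0 <= m < N) a m <= 1 -> (forall m, forms t (q m)) ->
  forms t (fun x => \sum_(0 <= m < N) a m * q m x).
Proof.
move=> a0 aN fq; split.
- split=> [x|k x|x y].
  + by rewrite sumr_ge0// => m _; rewrite mulr_ge0//; have [[+ _ _] _ _] := fq m; exact.
  + rewrite mulr_sumr ler_sum// => m _; have [[_ + _] _ _] := fq m => /(_ k x) H.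
    by rewrite mulrCA ler_wpM2l.
  + rewrite -big_split !mulr_sumr -big_split ler_sum// => m _.
    have [[_ _ +] _ _] := fq m => /(_ x y) H.
    by have := ler_wpM2l (a0 m) H => /=; lra.
- move=> M l; set S := \sum_(0 <= m < M) sqrmod (l m).
  have S0 : 0 <= S by rewrite sumr_ge0// => m _; exact: sqrmod_ge0.
  apply: (@le_trans _ _ (\sum_(0 <= m < N) a m * S)).
    by rewrite ler_sum// => m _; rewrite ler_wpM2l//; have [_ + _] := fq m; exact.
  by rewrite -mulr_suml ler_piMl.
- move=> e x; rewrite mulr_sumr ler_sum// => m _; rewrite mulrCA ler_wpM2l//.
  by have [_ _] := fq m; exact.
Qed.

Variables (theta c : R).
Hypotheses (theta0 : 0 <= theta) (c0 : 0 <= c)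
  (sim : similarity_property A c theta).

Lemma forms_similarity q : forms c q ->
  exists M q', [/\ 0 < M, forms theta q' & forall x, q x <= M * q' x].
Proof.
move=> [hq nq qc].
have [M [q' [M0 hq' q't qM q'M]]] := form_similarity (@fs_act1 _ _ A)
  (@fs_actM _ _ A) (@fs_actD _ _ A) (@fs_actZ _ _ A) (@fs_act_linear _ _ A)
  c0 theta0 sim hq qc.
exists (M * M), (fun x => M^-1 * q' x); split; first exact: mulr_gt0.
- have M'0 : 0 <= M^-1 by rewrite invr_ge0 ltW.
  split.
  + have [q0 qZ qp] := hq'; split=> [x|k x|x y]; first exact: mulr_ge0.
      by rewrite mulrCA ler_wpM2l.
    by have := ler_wpM2l M'0 (qp x y); lra.
  + by move=> N l; rewrite ler_pdivrMl// (le_trans (q'M _))// ler_wpM2l// ltW.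
  + by move=> a x; rewrite mulrCA ler_wpM2l.
- by move=> x; rewrite mulrA mulfK// gt_eqF.
Qed.

(** If no constant works, there are for every k a form q_k in [forms c] and a
    family on which q_k exceeds (k + 1) 2^(k + 1) times all the forms of bound
    theta.  The form sum_k 2^-(k+1) q_k is in [forms c], hence at most M times
    one of bound theta, and k >= M gives a contradiction. *)
Lemma forms_uniform : exists2 K, 0 < K & forall q n (tau : 'I_n -> V),
  forms c q -> exists2 q', forms theta q' &
    \sum_j q (tau j) <= K * \sum_j q' (tau j).
Proof.
apply: contrapT => N.
have bad k : exists qn : (V -> R) * {n & 'I_n -> V},
    forms c qn.1 /\ forall q', forms theta q' ->
      k.+1%:R * 2 ^+ k.+1 * \sum_j q' (projT2 qn.2 j) < \sum_j qn.1 (projT2 qn.2 j).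
  apply: contrapT => Nk; apply: N.
  exists (k.+1%:R * 2 ^+ k.+1); first by rewrite mulr_gt0// exprn_gt0.
  move=> q n tau fq; apply: contrapT => Nq; apply: Nk.
  exists (q, existT _ n tau); split => //= q' fq'.
  by rewrite ltNge; apply/negP => H; apply: Nq; exists q'.
have {bad}[qn bad] := choice bad.
pose S N x := \sum_(0 <= m < N) (2 ^+ m.+1)^-1 * (qn m).1 x.
have w0 m : 0 <= (2 ^+ m.+1 : R)^-1 by rewrite invr_ge0 exprn_ge0.
have Sc n : forms c (S n).
  apply: forms_sum => // [|m]; last by have [] := bad m.
  suff -> : \sum_(0 <= m < n) (2 ^+ m.+1)^-1 = 1 - (2 ^+ n)^-1 :> R.
    by rewrite lerBlDr lerDl invr_ge0 exprn_ge0.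
  elim: n => [|n IH]; first by rewrite big_nil expr0 invr1 subrr.
  rewrite big_nat_recr//= IH exprS; field.
  by rewrite expf_neq0.
have [||p pc Sp] := @compact_monotone R V (forms c) S (@forms_compact R H0 A c).
- exact: Sc.
- move=> n x; rewrite /S big_nat_recr//= lerDl mulr_ge0//.
  by have [[[+ _ _] _ _] _] := bad n; exact.
have [M [q' [M0 fq' pM]]] := forms_similarity pc.
pose k := Num.bound M; have [qc /(_ q' fq')] := bad k.
set X := \sum_j q' _; set Y := \sum_j (qn k).1 _ => XY.
have X0 : 0 <= X by apply: sumr_ge0 => j _; have [[+ _ _] _ _] := fq'; exact.
have : Y <= 2 ^+ k.+1 * M * X.
  rewrite /X mulr_sumr ler_sum// => j _; set x : V := projT2 (qn k).2 j.
  rewrite -mulrA -ler_pdivrMl ?exprn_gt0//; apply: le_trans (pM x).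
  apply: le_trans (Sp k.+1 x); rewrite /S big_nat_recr//= lerDr sumr_ge0// => m _.
  by rewrite mulr_ge0//; have [[[+ _ _] _ _] _] := bad m; exact.
rewrite leNgt => /negP; apply; apply: le_lt_trans XY.
rewrite ler_wpM2r// mulrC ler_wpM2r ?exprn_ge0//.
have := archi_boundP (ltW M0); rewrite -/k => /ltW/le_trans; apply.
by rewrite ler_nat.
Qed.

End forms_operations.

(** * Decomposition into layers *)

Lemma continuous_sum (R : realType) (T : topologicalType) (I : Type) (r : seq I)
    (F : I -> T -> R) : (forall i, continuous (F i)) ->
  continuous (fun q => \sum_(i <- r) F i q).
Proof.
move=> cF; elim: r => [|i r IH].
  under [X in continuous X]eq_fun do rewrite big_nil; exact: cst_continuous.
under [X in continuous X]eq_fun do rewrite big_cons.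
by move=> q; exact: (cvgD (cF i q) (IH q)).
Qed.

Lemma exists_expr_gt (R : realType) (b x : R) : 1 < b -> exists n, x < b ^+ n.
Proof.
move=> b1; have d0 : 0 < b - 1 by rewrite subr_gt0.
pose n := Num.bound (`|x| / (b - 1)); exists n.
have bern m : 1 + m%:R * (b - 1) <= b ^+ m.
  elim: m => [|m IH]; first by rewrite mul0r addr0 expr0.
  rewrite exprS; apply: le_trans (ler_wpM2l (ltW (lt_trans ltr01 b1)) IH).
  have : 0 <= m%:R * (b - 1) ^+ 2 :> R by rewrite mulr_ge0// sqr_ge0.
  by rewrite -[m.+1]add1n natrD; lra.
apply: lt_le_trans (bern n).
have : `|x| < n%:R * (b - 1).
  by rewrite -ltr_pdivrMr// archi_boundP// divr_ge0// ltW.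
by have := ler_norm x; lra.
Qed.

Section geometric_estimates.
Context {R : realType} (V : lmodType R[i]) (q : V -> R) (hq : hilbertian q).

(** Split off the first term with [hqD_le] for s = b - 1: the remaining sum
    picks up a factor b at each step. *)
Lemma hq_geometric_tail b (y : nat -> V) d M : 1 < b ->
  q (\sum_(d <= m < d + M) y m) <=
  b / (b - 1) * \sum_(d <= m < d + M) b ^+ (m - d) * q (y m).
Proof.
move=> b1; have d0 : 0 < b - 1 by rewrite subr_gt0.
have c0 : 0 <= b / (b - 1) by rewrite divr_ge0 ?ltW// (lt_trans ltr01).
elim: M d => [|M IH] d.
  by rewrite addn0 !big_geq// (hq0 hq) mulr0.
rewrite addnS -addSn big_ltn ?addSn ?ltnS ?leq_addr//.
rewrite [X in _ <= _ * X]big_ltn ?ltnS ?leq_addr// subnn expr0 mul1r.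
rewrite addrC; apply: le_trans (hqD_le hq _ _ d0) _.
have -> : 1 + (b - 1)^-1 = b / (b - 1) by field; rewrite gt_eqF.
rewrite mulrDr addrC lerD2l addrC subrK.
apply: le_trans (ler_wpM2l (ltW (lt_trans ltr01 b1)) (IH d.+1)) _.
rewrite mulrCA ler_wpM2l// mulr_sumr addSn.
apply: ler_sum_nat => m /andP[dm _].
by rewrite mulrA -exprS -subSn// subSS.
Qed.

Lemma hq_crude_sum (y : nat -> V) d :
  q (\sum_(0 <= m < d) y m) <= 2 ^+ d * \sum_(0 <= m < d) q (y m).
Proof.
elim: d => [|d IH]; first by rewrite !big_nil (hq0 hq) mulr0.
rewrite !big_nat_recr//=; have [_ _ /(_ (\sum_(0 <= m < d) y m) (y d))] := hq.
have := hq_ge0 hq (\sum_(0 <= m < d) y m - y d).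
rewrite exprS mulrDr; set S := \sum_(0 <= m < d) q (y m) in IH *.
have := hq_ge0 hq (y d); have : 1 <= 2 ^+ d :> R by rewrite exprn_ege1// ler1n.
move=> h1 y0; have : q (y d) <= 2 ^+ d * q (y d) by rewrite ler_peMl.
by lra.
Qed.

End geometric_estimates.

Section decomposition.
Context {R : realType} {H0 : hilbertType R} (A : op_alg H0).
Local Notation E := (oa_elt A).
Local Notation V := (fseq E).
Local Notation Y := (fseq V).
Local Notation forms := (@forms R H0 A).

Variables (theta c C K : R) (w : V -> R).
Hypotheses (theta0 : 0 < theta) (thetac : theta < c) (C0 : 0 < C) (K0 : 0 < K).
Hypothesis uniform : forall q n (tau : 'I_n -> V), forms c q ->
  exists2 q', forms theta q' & \sum_j q (tau j) <= K * \sum_j q' (tau j).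
Hypothesis wC : forms C w.

Let c0 : 0 < c. Proof. exact: lt_trans thetac. Qed.
Let alpha := (c / C) ^+ 2.
Let beta := (c / theta) ^+ 2.
Let alpha0 : 0 < alpha. Proof. by rewrite exprn_gt0// divr_gt0. Qed.
Let beta0 : 0 < beta. Proof. by rewrite exprn_gt0// divr_gt0. Qed.
Let beta1 : 1 < beta.
Proof. by rewrite exprn_egt1// ltr_pdivlMr// mul1r. Qed.

(** With y_m thought of as a part of degree m in A, the weights compensate for the
    growth of w and q under m multiplications, relative to the bound c. *)
Definition layer_form (q : V -> R) m (z : V) : R :=
  2^-1 * alpha ^+ m * w z + 2^-1 * beta ^+ m * q z.

Definition layered_form q : Y -> R := fsum (layer_form q).

Definition total : Y -> V := fsum (fun (_ : nat) (z : V) => z).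

Lemma layer_hilbertian q m : hilbertian q -> hilbertian (layer_form q m).
Proof.
have [hw _ _] := wC; move=> hq; apply: hilbertian_comb => //.
  by rewrite mulr_ge0// exprn_ge0// ltW.
by rewrite mulr_ge0// exprn_ge0// ltW.
Qed.

Lemma layered_hilbertian q : hilbertian q -> hilbertian (layered_form q).
Proof. by move=> hq; apply: fsum_hilbertian => m; exact: layer_hilbertian. Qed.

Lemma total_linear : linear total.
Proof. exact: (@fsumP _ _ _ (fun _ => idfun)). Qed.

Lemma totalD x y : total (x + y) = total x + total y.
Proof. by have := total_linear 1 x y; rewrite !scale1r. Qed.
Lemma totalZ k x : total (k *: x) = k *: total x.
Proof.
have t0 : total 0 = 0 by apply: (addrI (total 0)); rewrite -totalD !addr0.
by have := total_linear k x 0; rewrite !addr0 t0 addr0.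
Qed.
Lemma totalB x y : total (x - y) = total x - total y.
Proof. by rewrite -scaleN1r totalD totalZ scaleN1r. Qed.

Lemma total_single x m : total (single m x) = x.
Proof. exact: fsum_single. Qed.

Lemma total_surj x : exists y, total y = x.
Proof. by exists (single 0 x); exact: total_single. Qed.

Definition merged_form q : V -> R := quotient_form total (layered_form q).

Lemma shift_subproof (a : E) (y : Y) :
  (fun n => if n is m.+1 then fs_act a (y m) else 0) \in @finite_support R V.
Proof.
have [M yM] := fs_supp y; apply/mem_set; exists M.+1 => -[//|n]; rewrite ltnS.
by move=> /yM ->; apply: fs_ext => k /=; rewrite mulr0.
Qed.

Definition shift a y : Y := FSeq (shift_subproof a y).

Lemma fsum_shift (U : nmodType) (F : nat -> V -> U) a y : (forall m, F m 0 = 0) ->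
  fsum F (shift a y) = fsum (fun m z => F m.+1 (fs_act a z)) y.
Proof.
move=> F0; have [M yM] := fs_supp y.
rewrite (@fsum_widen _ _ _ F _ M.+1)//; last first.
  by move=> -[//|n]; rewrite ltnS => /yM /= ->; rewrite fs_act0.
rewrite (@fsum_widen _ _ _ _ _ M)//; last by move=> m; rewrite fs_act0.
by rewrite big_nat_recl//= F0 add0r.
Qed.

Lemma total_shift a y : total (shift a y) = fs_act a (total y).
Proof. by rewrite /total fsum_shift// /fsum fs_act_sum. Qed.

Lemma layered_shift q a y : forms theta q ->
  layered_form q (shift a y) <= (c * oa_norm a) ^+ 2 * layered_form q y.
Proof.
move=> [hq _ qt]; have [hw _ wt] := wC.
have L0 m : layer_form q m 0 = 0 by apply: hq0; exact: layer_hilbertian.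
rewrite /layered_form fsum_shift// /fsum mulr_sumr ler_sum// => m _.
rewrite /layer_form !exprSr.
have -> : 2^-1 * (alpha ^+ m * alpha) * w (fs_act a (y m)) =
    2^-1 * alpha ^+ m * (alpha * w (fs_act a (y m))) by ring.
have -> : 2^-1 * (beta ^+ m * beta) * q (fs_act a (y m)) =
    2^-1 * beta ^+ m * (beta * q (fs_act a (y m))) by ring.
rewrite mulrDr lerD//.
  rewrite [leRHS]mulrCA ler_wpM2l//.
    by rewrite mulr_ge0// exprn_ge0// ltW.
  apply: le_trans (ler_wpM2l (ltW alpha0) (wt a (y m))) _.
  rewrite le_eqVlt; apply/orP; left; apply/eqP; rewrite /alpha.
  by field; rewrite gt_eqF.
rewrite [leRHS]mulrCA ler_wpM2l//.
  by rewrite mulr_ge0// exprn_ge0// ltW.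
apply: le_trans (ler_wpM2l (ltW beta0) (qt a (y m))) _.
rewrite le_eqVlt; apply/orP; left; apply/eqP; rewrite /beta.
by field; rewrite gt_eqF.
Qed.

(** A representation x = sum_m y_m is turned into the representation
    a x = sum_m a y_m where a y_m is put in layer m + 1; the ratio of successive
    weights makes the cost of this c^2 |a|^2. *)
Lemma merged_forms q : forms theta q -> forms c (merged_form q).
Proof.
move=> fq; have [hq nq qt] := fq; have hL := layered_hilbertian hq.
have [L0 LZ Lp] := hL; have [hw nw _] := wC.
split.
- apply: (quotient_hilbertian (addX := +%R) (subX := fun x y => x - y)
    (sclX := *:%R)) => //; [exact: totalD|exact: totalB|exact: totalZ|exact: total_surj].
- move=> N l; set x := \sum_(0 <= m < N) _; rewrite -{1}(total_single x 0).
  apply: le_trans (quotient_le total_surj L0 _) _.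
  rewrite /layered_form fsum_single; last by move=> m; exact: (hq0 (layer_hilbertian m hq)).
  rewrite /layer_form !expr0 !mulr1.
  by have := nw N l; have := nq N l; rewrite -/x; lra.
- move=> a x; apply: quotient_scale => //; [exact: total_surj|exact: sqr_ge0|].
  by move=> y <-; exists (shift a y); [exact: total_shift|exact: layered_shift].
Qed.

Lemma layered_affine (p q : V -> R) s y :
  layered_form (fun x => s * p x + (1 - s) * q x) y =
  s * layered_form p y + (1 - s) * layered_form q y.
Proof.
rewrite /layered_form /fsum !mulr_sumr -big_split; apply: eq_bigr => m _.
by rewrite /layer_form /=; ring.
Qed.

(** Otherwise every decomposition has a form q for which the sum exceeds K + 1.
    The sum is affine in q and convex in the decomposition, so minimax gives one
    q that works for all decompositions, and then the merged form of q
    contradicts the choice of K. *)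
Lemma decomposition n (tau : 'I_n -> V) :
  (forall q, forms theta q -> \sum_j q (tau j) <= 1) ->
  exists2 y : 'I_n -> Y, forall j, total (y j) = tau j &
    forall q, forms theta q -> \sum_j layered_form q (y j) <= K + 1.
Proof.
move=> tau1; apply: contrapT => N.
pose I := {y : 'I_n -> Y | forall j, total (y j) = tau j}.
pose f (i : I) (q : {ptws V -> R}) : R := \sum_j layered_form q (sval i j) - (K + 1).
have [||i|p q s fp fq s01|i k s s01|i|q fq Hq] :=
    @minimax R {ptws V -> R} I (forms theta) f.
- by exists (fun _ => 0); exact: forms_zero.
- exact: forms_compact.
- have cf : continuous (fun q : {ptws V -> R} => \sum_j layered_form q (sval i j)).
    rewrite /layered_form /fsum /layer_form.
    apply: continuous_sum => j; apply: continuous_sum => m q.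
    set z := sval i j m; set a := _ * w z; set b := 2^-1 * beta ^+ m.
    have cb : continuous (fun q : {ptws V -> R} => b * q z).
      by move=> p; exact: (cvgM (cvg_cst b) (@ptws_eval_continuous R V z p)).
    have ca : continuous (fun q : {ptws V -> R} => a) by exact: cst_continuous.
    exact: (cvgD (ca q) (cb q)).
  by move=> q; exact: (cvgB (cf q) (cvg_cst _)).
- exists (fun x => s * p x + (1 - s) * q x); first exact: forms_convex.
  move=> i; rewrite /f.
  have -> : \sum_j layered_form (fun x => s * p x + (1 - s) * q x) (sval i j) =
     s * (\sum_j layered_form p (sval i j)) + (1 - s) * \sum_j layered_form q (sval i j).
    by rewrite !mulr_sumr -big_split; apply: eq_bigr => j _; exact: layered_affine.
  by ring.
- have yE j : total (s%:C *: sval i j + (1 - s)%:C *: sval k j) = tau j.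
    rewrite totalD !totalZ (svalP i) (svalP k) -scalerDl -rmorphD/= addrC subrK.
    by rewrite scale1r.
  exists (exist _ _ yE) => q [hq _ _]; rewrite /f/=.
  have : \sum_j layered_form q (s%:C *: sval i j + (1 - s)%:C *: sval k j) <=
      s * (\sum_j layered_form q (sval i j)) + (1 - s) * \sum_j layered_form q (sval k j).
    rewrite !mulr_sumr -big_split ler_sum// => j _.
    by apply: hq_convex => //; exact: layered_hilbertian.
  by lra.
- apply: contrapT => Ni; apply: N; exists (sval i); first exact: (svalP i).
  move=> q fq; rewrite leNgt; apply/negP => H; apply: Ni; exists q => //.
  by rewrite /f subr_ge0 ltW.
have [q' fq' Kq'] := uniform tau (merged_forms fq).
(* near minimizers at tau j, with total error at most 1/2 *)
have {Kq'} mK : \sum_j merged_form q (tau j) <= K.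
  apply: le_trans Kq' _; rewrite -[leRHS]mulr1 ler_wpM2l ?(ltW K0)//; exact: tau1.
have [hq _ _] := fq; have [L0 _ _] := layered_hilbertian hq.
have e0 : 0 < (2 * n.+1%:R)^-1 :> R by rewrite invr_gt0 mulr_gt0.
have /choice[y yH] j : exists y, total y = tau j /\
    layered_form q y < merged_form q (tau j) + (2 * n.+1%:R)^-1.
  by have [y ? ?] := quotient_near total_surj L0 (tau j) e0; exists y.
have := Hq (exist _ y (fun j => (yH j).1)); rewrite /f/= subr_ge0.
have : \sum_j layered_form q (y j) <= \sum_(j < n) (merged_form q (tau j) + (2 * n.+1%:R)^-1).
  by rewrite ler_sum// => j _; rewrite ltW//; exact: (yH j).2.
rewrite big_split/= sumr_const card_ord -[_ *+ n]mulr_natr.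
have : (2 * n.+1%:R)^-1 * n%:R <= 2^-1 :> R.
  rewrite invfM -mulrA ler_piMr// mulrC ler_pdivrMr// mul1r ler_nat.
  exact: leqnSn.
move: mK (_ * n%:R) => mK t t2 yM yK; have := le_trans yK yM.
by rewrite leNgt => /negP; apply; lra.
Qed.

End decomposition.

(** * Domination by a form of bound theta *)

Section domination.
Context {R : realType} {H0 : hilbertType R} (A : op_alg H0).
Local Notation E := (oa_elt A).
Local Notation V := (fseq E).
Local Notation Y := (fseq V).
Local Notation forms := (@forms R H0 A).

Variables (theta c C K : R).
Hypotheses (theta0 : 0 < theta) (thetac : theta < c) (C0 : 0 < C) (K0 : 0 < K).
Hypothesis uniform : forall q n (tau : 'I_n -> V), forms c q ->
  exists2 q', forms theta q' & \sum_j q (tau j) <= K * \sum_j q' (tau j).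

Let c0 : 0 < c. Proof. exact: lt_trans thetac. Qed.
Let alpha := (c / C) ^+ 2.
Let beta := (c / theta) ^+ 2.
Let alpha0 : 0 < alpha. Proof. by rewrite exprn_gt0// divr_gt0. Qed.
Let beta0 : 0 < beta. Proof. by rewrite exprn_gt0// divr_gt0. Qed.
Let beta1 : 1 < beta.
Proof. by rewrite exprn_egt1// ltr_pdivlMr// mul1r. Qed.

(** The layers below d, where powers of C are harmless, and the layers from d on,
    which have a geometrically small cost in terms of theta. *)
Definition head d (y : Y) : V := \sum_(0 <= m < d) y m.
Definition tail d (y : Y) : V := \sum_(d <= m < d + fs_len y) y m.

Lemma total_head_tail d (y : Y) : total y = head d y + tail d y.
Proof.
rewrite /total (@fsum_widen _ _ _ _ y (d + fs_len y))//.
  by rewrite (big_cat_nat (n := d))//= leq_addr.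
by move=> n dn; apply: fs_lenP; rewrite (leq_trans _ dn)// leq_addl.
Qed.

Section fixed_form.
Variable (w : V -> R).
Hypothesis wC : forms C w.
Local Notation layer := (layer_form theta c C w).
Local Notation layered := (layered_form theta c C w).

Lemma layer_ge0 q m z : forms theta q -> 0 <= layer q m z.
Proof. by move=> [hq _ _]; apply: hq_ge0; apply: layer_hilbertian. Qed.

Lemma layered_widen q d y : forms theta q ->
  layered q y = \sum_(0 <= m < d + fs_len y) layer q m (y m).
Proof.
move=> [hq _ _]; apply: fsum_widen => [m|n dn]; first by apply: hq0; apply: layer_hilbertian.
by apply: fs_lenP; rewrite (leq_trans _ dn)// leq_addl.
Qed.

Lemma layered_ge_head q d (y : Y) : forms theta q ->
  \sum_(0 <= m < d) layer q m (y m) <= layered q y.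
Proof.
move=> fq; rewrite (layered_widen d)// [leRHS](big_cat_nat (n := d))//= ?leq_addr//.
by rewrite lerDl sumr_ge0// => m _; exact: layer_ge0.
Qed.

Lemma layered_ge_tail q d (y : Y) : forms theta q ->
  \sum_(d <= m < d + fs_len y) layer q m (y m) <= layered q y.
Proof.
move=> fq; rewrite (layered_widen d)// [leRHS](big_cat_nat (n := d))//= ?leq_addr//.
by rewrite lerDr sumr_ge0// => m _; exact: layer_ge0.
Qed.

Definition head_constant d := 2 ^+ d * (2 * \sum_(0 <= m < d) (alpha ^+ m)^-1).

Lemma head_constant_ge0 d : 0 <= head_constant d.
Proof.
rewrite !mulr_ge0// ?exprn_ge0// sumr_ge0// => m _.
by rewrite invr_ge0 exprn_ge0// ltW.
Qed.

Lemma head_bound q d (y : Y) : forms theta q -> w (head d y) <= head_constant d * layered q y.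
Proof.
move=> fq; have [hw _ _] := wC; have [hq _ _] := fq.
apply: le_trans (hq_crude_sum hw y d) _; rewrite -mulrA ler_wpM2l ?exprn_ge0//.
apply: le_trans (ler_wpM2l _ (layered_ge_head d y fq)); last first.
  by rewrite mulr_ge0// sumr_ge0// => m _; rewrite invr_ge0 exprn_ge0// ltW.
rewrite mulr_sumr; apply: ler_sum_nat => m /andP[_ md].
set S := \sum_(0 <= m < d) _.
have Sm : (alpha ^+ m)^-1 <= S.
  rewrite /S (bigD1_seq m)/= ?mem_index_iota ?iota_uniq// lerDl sumr_ge0// => k _.
  by rewrite invr_ge0 exprn_ge0// ltW.
have am : 0 < alpha ^+ m by rewrite exprn_gt0.
have bm : 0 < beta ^+ m by rewrite exprn_gt0.
have S1 : 1 <= S * alpha ^+ m by rewrite -ler_pdivrMr// mul1r.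
have S0 : 0 <= S by apply: le_trans Sm; rewrite invr_ge0 ltW.
rewrite /layer_form -/alpha -/beta.
have := hq_ge0 hw (y m); have qy := hq_ge0 hq (y m) => wy.
have : 0 <= S * (beta ^+ m * q (y m)) by rewrite !mulr_ge0// ltW.
have : w (y m) <= S * alpha ^+ m * w (y m) by rewrite ler_peMl.
by lra.
Qed.

Lemma tail_bound q d (y : Y) : forms theta q ->
  q (tail d y) <= 2 * (beta / (beta - 1)) / beta ^+ d * layered q y.
Proof.
move=> fq; have [hq _ _] := fq; have [hw _ _] := wC.
apply: le_trans (hq_geometric_tail hq y d (fs_len y) beta1) _.
have bd : 0 < beta ^+ d by rewrite exprn_gt0.
have b0 : 0 <= beta / (beta - 1) by rewrite divr_ge0 ?(ltW beta0)// subr_ge0 ltW.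
have -> : 2 * (beta / (beta - 1)) / beta ^+ d * layered q y =
    beta / (beta - 1) * (2 / beta ^+ d * layered q y).
  by move: (beta / (beta - 1)) (beta ^+ d)^-1 (layered q y) => u v t; ring.
rewrite ler_wpM2l//.
apply: le_trans (ler_wpM2l _ (layered_ge_tail d y fq)); last first.
  by rewrite divr_ge0// ltW.
rewrite mulr_sumr; apply: ler_sum_nat => m /andP[dm _].
rewrite /layer_form -/alpha -/beta.
have := hq_ge0 hw (y m); have qy := hq_ge0 hq (y m) => wy.
have am : 0 < alpha ^+ m by rewrite exprn_gt0.
have -> : 2 / beta ^+ d * (2^-1 * alpha ^+ m * w (y m) +
    2^-1 * beta ^+ m * q (y m)) =
  alpha ^+ m / beta ^+ d * w (y m) + beta ^+ (m - d) * q (y m).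
  have -> : beta ^+ m = beta ^+ (m - d) * beta ^+ d by rewrite -exprD subnK.
  by field; rewrite gt_eqF.
by rewrite lerDr !mulr_ge0// ?invr_ge0 ltW.
Qed.

Hypothesis apriori : exists B, forall x,
  (forall q, forms theta q -> q x <= 1) -> w x <= B.

Definition unit_ball n : set ('I_n -> V) :=
  [set tau | forall q, forms theta q -> \sum_j q (tau j) <= 1].

(** A family in the unit ball is the sum of its head, where w is bounded, and of
    half of a family in the unit ball.  So the supremum s of w over the unit
    ball satisfies s <= 2 B + s / 2, where B bounds w on heads; it is finite by
    the a priori bound. *)
Lemma unit_ball_bound d n (tau : 'I_n -> V) :
  8 * (beta / (beta - 1)) * (K + 1) <= beta ^+ d ->
  unit_ball tau -> \sum_j w (tau j) <= 4 * (head_constant d * (K + 1)).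
Proof.
move=> dK tau1; have [hw _ _] := wC.
pose S := [set \sum_j w (sigma j) | sigma in @unit_ball n].
have bd : 0 < beta ^+ d by rewrite exprn_gt0.
have [B HB] := apriori.
have Ssup : has_sup S.
  split; first by exists (\sum_j w (tau j)), tau.
  exists (\sum_(j < n) B) => _ [sigma s1 <-]; apply: ler_sum => j _.
  apply: HB => q fq; apply: le_trans (s1 q fq).
  by rewrite (bigD1 j)//= lerDl sumr_ge0// => i _; have [hq _ _] := fq; exact: hq_ge0.
suff step : forall sigma : 'I_n -> V, unit_ball sigma ->
    \sum_j w (sigma j) <= 2 * (head_constant d * (K + 1)) + 2^-1 * sup S.
  have : sup S <= 2 * (head_constant d * (K + 1)) + 2^-1 * sup S.
    by apply: ge_sup; [exact: Ssup.1|move=> _ [sigma s1 <-]; exact: step].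
  have : \sum_j w (tau j) <= sup S by apply: (ub_le_sup Ssup.2); exists tau.
  by lra.
move=> sigma s1.
have [y yE yK] := decomposition theta0 thetac C0 K0 uniform wC s1.
have headK : \sum_j w (head d (y j)) <= head_constant d * (K + 1).
  have f0 := @forms_zero R H0 A theta.
  apply: le_trans (ler_wpM2l (head_constant_ge0 d) (yK _ f0)).
  by rewrite mulr_sumr ler_sum// => j _; exact: head_bound.
have tail1 : unit_ball (fun j => 2%:C *: tail d (y j)).
  move=> q fq; have [hq _ _] := fq.
  apply: (@le_trans _ _ (\sum_j 4 * (2 * (beta / (beta - 1)) / beta ^+ d * layered q (y j)))).
    apply: ler_sum => j _; rewrite (hqZr hq) (_ : 2 ^+ 2 = 4); last by ring.
    by rewrite ler_wpM2l//; exact: tail_bound.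
  rewrite -!mulr_sumr; have := yK q fq.
  set L := \sum_j _ => LK; rewrite -(ler_pM2r bd) mul1r; apply: le_trans dK.
  have b0 : 0 <= beta / (beta - 1) by rewrite divr_ge0 ?(ltW beta0)// subr_ge0 ltW.
  rewrite [leLHS](_ : _ = 8 * (beta / (beta - 1)) * L); last first.
    by move: (beta / (beta - 1)) => u; field; rewrite gt_eqF.
  by rewrite ler_wpM2l// mulr_ge0.
have tailS : 4 * \sum_j w (tail d (y j)) <= sup S.
  apply: (ub_le_sup Ssup.2); exists (fun j => 2%:C *: tail d (y j)) => //.
  by rewrite mulr_sumr; apply: eq_bigr => j _; rewrite (hqZr hw); congr (_ * _); ring.
have : \sum_j w (sigma j) <= 2 * \sum_j w (head d (y j)) + 2 * \sum_j w (tail d (y j)).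
  rewrite !mulr_sumr -big_split ler_sum// => j _.
  rewrite -yE (total_head_tail d); have [_ _ /(_ (head d (y j)) (tail d (y j)))] := hw.
  by have := hq_ge0 hw (head d (y j) - tail d (y j)) => /=; lra.
by lra.
Qed.

(** Were w larger than 2 D q for all q, a rescaling of the family would lie in
    the unit ball and have w = 2 D. *)
Lemma tuple_bound D n (tau : 'I_n -> V) : 0 < D ->
  (forall sigma : 'I_n -> V, unit_ball sigma -> \sum_j w (sigma j) <= D) ->
  exists2 q, forms theta q & \sum_j w (tau j) <= 2 * D * \sum_j q (tau j).
Proof.
move=> D0 HD; apply: contrapT => N; have [hw _ _] := wC.
have {}N q : forms theta q -> 2 * D * \sum_j q (tau j) < \sum_j w (tau j).
  by move=> fq; rewrite ltNge; apply/negP => H; apply: N; exists q.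
set S := \sum_j w (tau j) in N.
have S0 : 0 < S.
  by have := N _ (@forms_zero _ _ A theta); rewrite big1// mulr0.
pose t := Num.sqrt (2 * D / S).
have t2 : t ^+ 2 = 2 * D / S by rewrite sqr_sqrtr// divr_ge0 ?mulr_ge0// ltW.
have : unit_ball (fun j => t%:C *: tau j).
  move=> q fq; have [hq _ _] := fq; under eq_bigr do rewrite (hqZr hq) t2.
  by rewrite -mulr_sumr mulrAC ler_pdivrMr// mul1r ltW// N.
move/HD; under eq_bigr do rewrite (hqZr hw) t2.
rewrite -mulr_sumr -/S divfK ?gt_eqF//; lra.
Qed.

(** Minimax over the finite families: a convex combination of the conditions for
    two families is the condition for the concatenation of their multiples by
    the square roots of the weights. *)
Lemma form_bound D : 0 < D ->
  (forall n (sigma : 'I_n -> V), unit_ball sigma -> \sum_j w (sigma j) <= D) ->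
  exists2 q, forms theta q & forall x, w x <= 2 * D * q x.
Proof.
move=> D0 HD; have [hw _ _] := wC.
pose I := {n & 'I_n -> V}.
pose f (i : I) (q : {ptws V -> R}) : R :=
  2 * D * \sum_j q (projT2 i j) - \sum_j w (projT2 i j).
have [||i|p q s fp fq s01|i k s /andP[s0 s1]|i|q fq Hq] :=
    @minimax R {ptws V -> R} I (forms theta) f.
- by exists (fun _ => 0); exact: forms_zero.
- exact: forms_compact.
- have cs : continuous (fun q : {ptws V -> R} => \sum_j q (projT2 i j)).
    by apply: continuous_sum => j; exact: ptws_eval_continuous.
  by move=> q; exact: (cvgB (cvgM (cvg_cst (2 * D)) (cs q)) (cvg_cst _)).
- exists (fun x => s * p x + (1 - s) * q x); first exact: forms_convex.
  by move=> i; rewrite /f big_split/= -!mulr_sumr; ring.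
- pose sig (j : 'I_(projT1 i + projT1 k)) : V := match fintype.split j with
    | inl a => (Num.sqrt s)%:C *: projT2 i a
    | inr b => (Num.sqrt (1 - s))%:C *: projT2 k b end.
  have sumE q : hilbertian q -> \sum_j q (sig j) =
      s * \sum_j q (projT2 i j) + (1 - s) * \sum_j q (projT2 k j).
    move=> hq; rewrite big_split_ord/= !mulr_sumr; congr (_ + _); apply: eq_bigr => j _.
      by rewrite /sig (unsplitK (inl j)) (hqZr hq) sqr_sqrtr.
    by rewrite /sig (unsplitK (inr j)) (hqZr hq) sqr_sqrtr// subr_ge0.
  exists (existT _ _ sig) => q [hq _ _]; rewrite /f/= !sumE//.
  by rewrite le_eqVlt; apply/orP; left; apply/eqP; ring.
- have [q fq H] := tuple_bound (projT2 i) D0 (HD _).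
  by exists q => //; rewrite /f subr_ge0.
exists q => // x; have := Hq (existT _ 1%N (fun _ => x)).
by rewrite /f/= !big_ord_recl !big_ord0 !addr0 subr_ge0.
Qed.

End fixed_form.

Lemma domination : exists2 D, 0 < D & forall w, forms C w ->
  (exists B, forall x, (forall q, forms theta q -> q x <= 1) -> w x <= B) ->
  exists2 q, forms theta q & forall x, w x <= D * q x.
Proof.
have [d dK] := exists_expr_gt (8 * (beta / (beta - 1)) * (K + 1)) beta1.
have D0 : 0 < 4 * (head_constant d * (K + 1)) + 1.
  have K1 : 0 <= K + 1 by rewrite addr_ge0// ltW.
  by apply: ltr_wpDl => //; apply: mulr_ge0 => //; apply: mulr_ge0 (head_constant_ge0 d) K1.
exists (2 * (4 * (head_constant d * (K + 1)) + 1)); first by rewrite mulr_gt0.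
move=> w wC wB; apply: form_bound => // n sigma s1.
apply: (le_trans (unit_ball_bound wC wB (ltW dK) s1)).
by rewrite lerDl.
Qed.

End domination.

(** * Forms given by vectors *)

Section vectors.
Context {R : realType} {H0 : hilbertType R} (A : op_alg H0).
Local Notation E := (oa_elt A).
Local Notation V := (fseq E).
Local Notation forms := (@forms R H0 A).

Section evaluation.
Variables (H : hilbertType R) (u : 'B(H0) -> 'B(H)) (C : R).
Hypotheses (C0 : 0 <= C) (um : unital_morphism A u) (uC : (opnorm A u <= C%:E)%E).

Lemma morphism1 : u (oa_val (1 : E)) = 1. Proof. by have [] := um. Qed.
Lemma morphismM (a b : E) : u (oa_val (a * b)) = u (oa_val a) * u (oa_val b).
Proof. by have [_ uM _ _] := um; apply: uM; exact: oa_in. Qed.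
Lemma morphismD (a b : E) : u (oa_val (a + b)) = u (oa_val a) + u (oa_val b).
Proof. by have [_ _ uD _] := um; apply: uD; exact: oa_in. Qed.
Lemma morphismZ k (a : E) : u (oa_val (k *: a)) = k *: u (oa_val a).
Proof. by have [_ _ _ uZ] := um; apply: uZ; exact: oa_in. Qed.
Lemma morphism0 : u (oa_val (0 : E)) = 0.
Proof. by rewrite -(scale0r 0) morphismZ scale0r. Qed.
Lemma morphism_rnorm (a : E) h : rnorm (u (oa_val a) h) <= C * oa_norm a * rnorm h.
Proof. by rewrite -lecR realcM !rnormE; exact: morphism_norm. Qed.

Variables (N : nat) (T : nat -> H).
Hypothesis T_contraction : forall l : nat -> R[i],
  rnorm (\sum_(0 <= m < N) l m *: T m) ^+ 2 <= \sum_(0 <= m < N) sqrmod (l m).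

Definition vec_eval (x : V) : H := \sum_(0 <= m < N) u (oa_val (x m)) (T m).

Definition vec_form (x : V) : R := rnorm (vec_eval x) ^+ 2.

Lemma vec_eval_linear : linear vec_eval.
Proof.
move=> k x y; rewrite /vec_eval scaler_sumr -big_split; apply: eq_bigr => m _.
by rewrite fsD fsZ morphismD morphismZ.
Qed.

Lemma vec_eval_act a x : vec_eval (fs_act a x) = u (oa_val a) (vec_eval x).
Proof.
rewrite /vec_eval linear_sum; apply: eq_bigr => m _.
by rewrite -[fs_act a x m]/(a * x m) morphismM.
Qed.

Lemma vec_eval_units M l :
  vec_eval (\sum_(0 <= m < M) l m *: unit_vector A m) =
  \sum_(0 <= m < N) (if (m < M)%N then l m else 0) *: T m.
Proof.
apply: eq_bigr => m _; rewrite fs_sumE.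
have -> : \sum_(0 <= k < M) (l k *: unit_vector A k) m =
    (if (m < M)%N then l m else 0) *: (1 : E).
  case: ifP => mM.
    rewrite (bigD1_seq m) ?mem_index_iota ?iota_uniq// big1; last first.
      by move=> k km; rewrite fsZ /= eq_sym (negPf km) scaler0.
    by rewrite fsZ /= eqxx addr0.
  rewrite scale0r big_nat big1// => k /andP[_ kM]; rewrite fsZ /=.
  by case: eqP => [mk|_]; [rewrite mk kM in mM|rewrite scaler0].
by rewrite morphismZ morphism1.
Qed.

Lemma vec_form_forms : forms C vec_form.
Proof.
split.
- exact: (hilbertian_comp vec_eval_linear (hilbertian_norm H)).
- move=> M l; rewrite /vec_form vec_eval_units; apply: le_trans (T_contraction _) _.
  have [MN|/ltnW NM] := leqP M N.
    rewrite (big_cat_nat (n := M))//=.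
    have -> : \sum_(M <= m < N) sqrmod (if (m < M)%N then l m else 0) = 0.
      rewrite big_nat big1// => m /andP[Mm _].
      by rewrite ltnNge Mm/= /sqrmod/= expr0n addr0.
    by rewrite addr0; apply: ler_sum_nat => m /andP[_ ->].
  rewrite [leRHS](big_cat_nat (n := N))//= ler_wpDr//.
    by rewrite sumr_ge0// => m _; exact: sqrmod_ge0.
  by apply: ler_sum_nat => m /andP[_ mN]; rewrite (leq_trans mN NM).
- move=> a x; rewrite /vec_form vec_eval_act -exprMn.
  by rewrite ler_pXn2r ?nnegrE ?mulr_ge0 ?rnorm_ge0 ?oa_norm_ge0//; exact: morphism_rnorm.
Qed.

(** This is where the action of A on H_0 is used: the inclusion of A into B(H_0) is
    a morphism of norm at most 1, hence of norm at most theta. *)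
Lemma coordinate_form theta n (z : H0) : 1 <= theta -> rnorm z <= 1 ->
  forms theta (fun x : V => rnorm (oa_val (x n) z) ^+ 2).
Proof.
move=> theta1 z1; split.
- apply: (hilbertian_comp (f := fun x : V => oa_val (x n) z) _ (hilbertian_norm H0)).
  by move=> k x y; rewrite fsD fsZ.
- move=> M l; rewrite fs_sumE.
  have [nM|Mn] := ltnP n M.
    rewrite (bigD1_seq n) ?mem_index_iota ?iota_uniq// big1; last first.
      by move=> k km; rewrite fsZ /= eq_sym (negPf km) scaler0.
    rewrite [leRHS](bigD1_seq n) ?mem_index_iota ?iota_uniq//.
    rewrite fsZ /= eqxx addr0.
    change (rnorm (l n *: z) ^+ 2 <=
      sqrmod (l n) + \sum_(0 <= i < M | i != n) sqrmod (l i)).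
    rewrite rnormZ.
    rewrite ler_wpDr ?sumr_ge0// => [k _|]; first exact: sqrmod_ge0.
    by rewrite ler_piMr ?sqrmod_ge0// exprn_ile1 ?rnorm_ge0.
  rewrite big_nat big1 => [|k /andP[_ kM]].
    by rewrite rnorm0 expr0n sumr_ge0// => m _; exact: sqrmod_ge0.
  by rewrite fsZ /= gtn_eqF ?scaler0// (leq_trans kM).
- move=> a x; rewrite -[oa_val (fs_act a x n) z]/(oa_val a (oa_val (x n) z)) -exprMn.
  rewrite ler_pXn2r ?nnegrE ?mulr_ge0 ?rnorm_ge0 ?oa_norm_ge0//.
    have := bop_norm_ge (oa_val a) (oa_val (x n) z).
    rewrite -[bop_norm (oa_val a)]/(`|oa_val a|) -rnormE -[`|oa_val a|]rnormE -rnormE.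
    rewrite -realcM lecR => /le_trans; apply; rewrite ler_wpM2r ?rnorm_ge0//.
    by rewrite ler_peMl ?oa_norm_ge0.
  by rewrite (le_trans ler01).
Qed.

(** If all forms of bound theta are at most 1 at x, the coordinate forms show that
    each x_m has norm at most 1. *)
Lemma vec_form_apriori theta : 1 <= theta -> exists B, forall x,
  (forall q, forms theta q -> q x <= 1) -> vec_form x <= B.
Proof.
move=> theta1; exists ((\sum_(0 <= m < N) C * rnorm (T m)) ^+ 2) => x x1.
have S0 : 0 <= \sum_(0 <= m < N) C * rnorm (T m).
  by rewrite sumr_ge0// => m _; rewrite mulr_ge0// rnorm_ge0.
rewrite ler_pXn2r ?nnegrE ?rnorm_ge0//; apply: le_trans (rnorm_sum _ _) _.
apply: ler_sum => m _; apply: le_trans (morphism_rnorm _ _) _.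
rewrite ler_wpM2r ?rnorm_ge0// ler_piMr//.
rewrite /oa_norm -lecR Re_normE; apply: bop_norm_le => // z.
rewrite mul1r -!rnormE lecR; have [->|z0] := eqVneq z 0; first by rewrite linear0 rnorm0.
have nz : 0 < rnorm z by rewrite -ltcR rnormE normr_gt0.
have z1 : rnorm ((rnorm z)^-1%:C *: z) <= 1.
  rewrite -(@ler_pXn2r _ 2)// ?nnegrE ?rnorm_ge0// rnormZ sqrmodC expr1n -exprMn mulVf ?gt_eqF//.
have := x1 _ (coordinate_form m theta1 z1).
rewrite linearZ rnormZ sqrmodC -exprMn -[leRHS](expr1n _ 2).
rewrite ler_pXn2r ?nnegrE ?mulr_ge0 ?invr_ge0 ?rnorm_ge0//.
by rewrite mulrC ler_pdivrMr// mul1r.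
Qed.

End evaluation.
End vectors.

(** * Orthonormal families *)

Section gram_schmidt.
Context {R : realType} (H : hilbertType R).
Implicit Types (x y h : H) (T : nat -> H) (N : nat).
Local Notation ip := (inner : H -> H -> R[i]).

Lemma ipxx x : ip x x = (rnorm x ^+ 2)%:C.
Proof.
by rewrite realcX rnormE -normr_inner.
Qed.

Lemma ipC x y : ip x y = (ip y x)^*.
Proof. by rewrite [LHS]hermitian_subproof expr0 mul1r. Qed.

Lemma ipDl x y z : ip (x + y) z = ip x z + ip y z. Proof. exact: linearDl. Qed.
Lemma ipBl x y z : ip (x - y) z = ip x z - ip y z. Proof. exact: linearBl. Qed.
Lemma ipZl k x z : ip (k *: x) z = k * ip x z. Proof. exact: linearZl_LR. Qed.
Lemma ip0l z : ip 0 z = 0. Proof. exact: linear0l. Qed.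
Lemma ip_suml (I : Type) (r : seq I) (F : I -> H) z :
  ip (\sum_(m <- r) F m) z = \sum_(m <- r) ip (F m) z.
Proof.
elim: r => [|m r IH]; first by rewrite !big_nil ip0l.
by rewrite !big_cons ipDl IH.
Qed.

Definition orthonormal_upto N T :=
  forall i j, (i < N)%N -> (j < N)%N -> ip (T i) (T j) = (i == j)%:R.

Definition projection N T h : H := \sum_(0 <= m < N) ip h (T m) *: T m.

Lemma ip_combination N T (l : nat -> R[i]) j : orthonormal_upto N T -> (j < N)%N ->
  ip (\sum_(0 <= m < N) l m *: T m) (T j) = l j.
Proof.
move=> on jN; rewrite ip_suml (bigD1_seq j) ?mem_index_iota ?iota_uniq//.
rewrite ipZl on// eqxx mulr1 big_nat_cond big1 => [|m /andP[/andP[_ mN] mj]].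
  exact: addr0.
by rewrite ipZl on// (negPf mj) mulr0.
Qed.

Lemma rnorm_combination N T (l : nat -> R[i]) : orthonormal_upto N T ->
  rnorm (\sum_(0 <= m < N) l m *: T m) ^+ 2 = \sum_(0 <= m < N) sqrmod (l m).
Proof.
move=> on; apply: complexI; rewrite -ipxx {1}ip_suml rmorph_sum.
apply: eq_big_nat => m /andP[_ mN].
rewrite ipZl ipC ip_combination// -[RHS]/((sqrmod (l m))%:C) sqrmodE.
by rewrite normCK.
Qed.

Lemma bessel N T h : orthonormal_upto N T ->
  \sum_(0 <= m < N) sqrmod (ip h (T m)) <= rnorm h ^+ 2.
Proof.
move=> on; rewrite -(rnorm_combination _ on) -/(projection N T h).
set p := projection N T h.
have hp : ip h p = ip p p.
  rewrite ipC [RHS]ipC; congr (_^*); rewrite /p /projection !ip_suml.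
  apply: eq_big_nat => m /andP[_ mN]; rewrite !ipZl; congr (_ * _).
  by rewrite [RHS]ipC ip_combination// -ipC.
have E : ip (h - p) (h - p) = ip h h - ip p p.
  rewrite ipBl [ip h (h - p)]ipC [ip p (h - p)]ipC !ipBl.
  have ph : ip p h = ip p p by rewrite ipC hp -ipC.
  by rewrite !rmorphB/= -!ipC hp ph subrr subr0.
have : 0 <= rnorm (h - p) ^+ 2 by rewrite sqr_ge0.
by rewrite -lecR -ipxx E !ipxx -realcN -realcD lecR subr_ge0.
Qed.

Lemma gram_schmidt (s : seq H) : exists N T, orthonormal_upto N T /\
  forall h, h \in s -> projection N T h = h.
Proof.
elim: s => [|h s [N [T [on sp]]]].
  by exists 0%N, (fun _ => 0); split.
pose r := h - projection N T h.
have [r0|r0] := eqVneq r 0.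
  exists N, T; split => // k; rewrite inE => /orP[/eqP ->|]; last exact: sp.
  by apply/esym/eqP; rewrite -subr_eq0 -/r r0.
have rT j : (j < N)%N -> ip r (T j) = 0.
  by move=> jN; rewrite ipBl ip_combination// subrr.
pose v := (rnorm r)^-1%:C *: r.
have nr : rnorm r != 0.
  by apply: contra r0 => /eqP r0; rewrite -normr_eq0 -rnormE r0.
pose T' m := if m == N then v else T m.
have TN m : (m < N)%N -> T' m = T m by move=> mN; rewrite /T' ltn_eqF.
have vT j : (j < N)%N -> ip v (T j) = 0 by move=> jN; rewrite ipZl rT// mulr0.
have on' : orthonormal_upto N.+1 T'.
  have nv : ip v v = 1.
    by rewrite ipxx rnormZ sqrmodC -exprMn mulVf// expr1n.
  move=> i j; rewrite !ltnS [(i <= N)%N]leq_eqVlt [(j <= N)%N]leq_eqVlt.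
  move=> /orP[/eqP ->|iN] /orP[/eqP ->|jN].
  - by rewrite /T' eqxx.
  - by rewrite (TN j)// /T' eqxx vT// gtn_eqF.
  - by rewrite (TN i)// /T' eqxx ipC vT// rmorph0 ltn_eqF.
  - by rewrite !TN// on.
have T'N : T' N = v by rewrite /T' eqxx.
have projS k : projection N.+1 T' k = projection N T k + ip k v *: v.
  rewrite /projection big_nat_recr//= T'N; congr (_ + _).
  by apply: eq_big_nat => m /andP[_ mN]; rewrite TN.
exists N.+1, T'; split=> // k; rewrite inE => /orP[/eqP ->|ks].
  have hv : ip h v = (rnorm r)%:C.
    have -> : h = projection N T h + r by rewrite /r addrC subrK.
    rewrite ipDl ip_suml big_nat big1 ?add0r => [|m /andP[_ mN]]; last first.
      by rewrite ipZl [ip (T m) v]ipC vT// rmorph0 mulr0.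
    by rewrite ipC ipZl ipxx -realcM expr2 mulKf// conjc_real.
  by rewrite projS hv /v scalerA -realcM mulfV// scale1r /r addrC subrK.
rewrite projS sp// -{2}(sp k ks) ip_suml big_nat big1 ?scale0r ?addr0// => m /andP[_ mN].
by rewrite ipZl [ip (T m) v]ipC vT// rmorph0 mulr0.
Qed.

End gram_schmidt.

(** * Formal sums and the passage to the limit over orthonormal families *)

Section formal_sums.
Context {R : realType} {H0 : hilbertType R} (A : op_alg H0) (H : hilbertType R).
Local Notation E := (oa_elt A).
Local Notation V := (fseq E).
Local Notation X := (seq (E * H)).
Local Notation forms := (@forms R H0 A).
Local Notation ip := (inner : H -> H -> R[i]).

(** A list of pairs (a, h) stands for the sum of the a (x) h in the tensor product
    of A and H; no quotient is taken, as forms on lists suffice. *)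
Definition formal_scale (k : R[i]) (l : X) : X := [seq (k *: p.1, p.2) | p <- l].
Definition formal_act (a : E) (l : X) : X := [seq (a * p.1, p.2) | p <- l].

Section coordinates.
Variables (N : nat) (T : nat -> H).

(** The coordinates in A of the orthogonal projection of a formal sum onto the
    span of the T_m. *)
Definition coord1 (a : E) (h : H) : V := \sum_(0 <= m < N) ip h (T m) *: single m a.
Definition coord (l : X) : V := \sum_(p <- l) coord1 p.1 p.2.

Lemma singleZ m k (a : E) : single m (k *: a) = k *: single m a.
Proof. by apply: fs_ext => n; rewrite fsZ /=; case: eqP; rewrite ?scaler0. Qed.

Lemma fs_act_single (a b : E) m : fs_act a (single m b) = single m (a * b).
Proof. by apply: fs_ext => n /=; case: eqP; rewrite ?mulr0. Qed.

Lemma coord_cat l l' : coord (l ++ l') = coord l + coord l'.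
Proof. exact: big_cat. Qed.

Lemma coord_scale k l : coord (formal_scale k l) = k *: coord l.
Proof.
rewrite /coord big_map scaler_sumr; apply: eq_bigr => p _ /=.
rewrite /coord1 scaler_sumr; apply: eq_bigr => m _.
by rewrite singleZ !scalerA mulrC.
Qed.

Lemma coord_act a l : coord (formal_act a l) = fs_act a (coord l).
Proof.
rewrite /coord big_map fs_act_sum; apply: eq_bigr => p _ /=.
rewrite /coord1 fs_act_sum; apply: eq_bigr => m _.
by rewrite fs_act_scale fs_act_single.
Qed.

Lemma coord_unit h : coord [:: (1, h)] = \sum_(0 <= m < N) ip h (T m) *: unit_vector A m.
Proof. by rewrite /coord big_seq1. Qed.

Variables (u : 'B(H0) -> 'B(H)).
Hypothesis um : unital_morphism A u.

Definition formal_eval (l : X) : H := \sum_(p <- l) u (oa_val p.1) p.2.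

Local Notation veval := (vec_eval (A := A) u N T).

Lemma vec_eval_coord l : (forall p, p \in l -> projection N T p.2 = p.2) ->
  veval (coord l) = formal_eval l.
Proof.
move=> lT; have lin := vec_eval_linear um N T.
have v0 : veval 0 = 0.
  by apply: big1 => m _; rewrite fs0 (morphism0 um).
have vD x y : veval (x + y) = veval x + veval y.
  by have := lin 1 x y; rewrite !scale1r.
have vZ k x : veval (k *: x) = k *: veval x.
  by have := lin k x 0; rewrite v0 !addr0.
have vsum (I : Type) (r : seq I) (F : I -> V) :
    veval (\sum_(i <- r) F i) = \sum_(i <- r) veval (F i).
  by elim: r => [|i r IH]; rewrite ?big_nil// !big_cons vD IH.
rewrite /coord vsum /formal_eval big_seq [RHS]big_seq; apply: eq_bigr => -[a h] /lT /= {2}<-.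
rewrite /coord1 vsum /projection linear_sum; apply: eq_big_nat => m /andP[_ mN].
rewrite vZ linearZ; congr (_ *: _); rewrite /vec_eval.
rewrite (bigD1_seq m) ?mem_index_iota ?iota_uniq//= eqxx big1 ?addr0// => k km.
by rewrite (negPf km) (morphism0 um).
Qed.

End coordinates.

Variable theta : R.

(** The list analogue of [forms], with the norm of H in place of that of the
    scalar sequences. *)
Definition formal_forms : set {ptws X -> R} := [set Q |
  [/\ forall l, 0 <= Q l,
      forall k l, Q (formal_scale k l) <= sqrmod k * Q l,
      forall l l', Q (l ++ l') + Q (l ++ formal_scale (- 1) l') <= 2 * Q l + 2 * Q l',
      forall h, Q [:: (1, h)] <= rnorm h ^+ 2
    & forall a l, Q (formal_act a l) <= (theta * oa_norm a) ^+ 2 * Q l]].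

Lemma formal_forms_bounded l : exists B, forall Q, formal_forms Q -> 0 <= Q l <= B.
Proof.
elim: l => [|[a h] l [B IH]].
  exists 0 => Q [Q0 QZ _ _ _]; rewrite Q0/=.
  by have := QZ 0 [::]; rewrite /sqrmod/= expr0n addr0 mul0r.
exists (2 * ((theta * oa_norm a) ^+ 2 * rnorm h ^+ 2) + 2 * B) => Q fQ.
have /andP[_ QB] := IH Q fQ; have [Q0 QZ Qp Qn Qa] := fQ; rewrite Q0/=.
have := Qa a [:: (1, h)]; rewrite /= mulr1 => ah.
have := ler_wpM2l (sqr_ge0 (theta * oa_norm a)) (Qn h).
have := Qp [:: (a, h)] l; have := Q0 ([:: (a, h)] ++ formal_scale (-1) l).
by rewrite /=; lra.
Qed.

Lemma formal_forms_closed : closed formal_forms.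
Proof.
have ev := @ptws_eval_continuous R X.
have cM k x : continuous (fun q : {ptws X -> R} => k * q x).
  by move=> q; exact: (cvgM (cvg_cst k) (ev x q)).
rewrite (_ : formal_forms = [set Q : {ptws X -> R} | forall l, 0 <= Q l] `&`
  ([set Q : {ptws X -> R} | forall kl : R[i] * X,
     Q (formal_scale kl.1 kl.2) <= sqrmod kl.1 * Q kl.2] `&`
  ([set Q : {ptws X -> R} | forall ll : X * X,
     Q (ll.1 ++ ll.2) + Q (ll.1 ++ formal_scale (-1) ll.2) <= 2 * Q ll.1 + 2 * Q ll.2] `&`
  ([set Q : {ptws X -> R} | forall h : H, Q [:: (1, h)] <= rnorm h ^+ 2] `&`
   [set Q : {ptws X -> R} | forall al : E * X,
     Q (formal_act al.1 al.2) <= (theta * oa_norm al.1) ^+ 2 * Q al.2])))).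
  do 4?[apply: closedI]; apply: closed_ineq => j;
    try exact: cst_continuous; try exact: ev; try exact: cM.
    by move=> q; exact: (cvgD (ev _ q) (ev _ q)).
  by move=> q; exact: (cvgD (cM _ _ q) (cM _ _ q)).
apply/seteqP; split=> q.
  move=> [q0 qZ qp qn qa]; do ?split; first exact: q0.
  - by case=> *; exact: qZ.
  - by case=> *; exact: qp.
  - exact: qn.
  - by case=> *; exact: qa.
move=> [q0 [qZ [qp [qn qa]]]]; split.
- exact: q0.
- by move=> k x; exact: (qZ (k, x)).
- by move=> x y; exact: (qp (x, y)).
- exact: qn.
- by move=> a x; exact: (qa (a, x)).
Qed.

(** Bessel's inequality is the normalization. *)
Lemma formal_forms_coord N T q : orthonormal_upto N T -> forms theta q ->
  formal_forms (fun l => q (coord N T l)).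
Proof.
move=> on [hq nq tq]; split=> [l|k l|l l'|h|a l].
- exact: hq_ge0.
- by rewrite coord_scale; have [_ + _] := hq; exact.
- by rewrite !coord_cat coord_scale scaleN1r; have [_ _] := hq; exact.
- by rewrite coord_unit; apply: le_trans (nq _ _) _; exact: bessel.
- by rewrite coord_act.
Qed.

Section renorming.
Variables (C D : R) (u : 'B(H0) -> 'B(H)).
Hypotheses (theta1 : 1 <= theta) (C0 : 0 <= C) (D0 : 0 < D).
Hypotheses (um : unital_morphism A u) (uC : (opnorm A u <= C%:E)%E).
Hypothesis dominated_by_D : forall w, forms C w ->
  (exists B, forall x, (forall q, forms theta q -> q x <= 1) -> w x <= B) ->
  exists2 q, forms theta q & forall x, w x <= D * q x.

(** For finitely many lists there is a common orthonormal family whose span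
    contains all the vectors that occur in them, and the corresponding form
    satisfies the inequality for these lists.  Compactness does the rest. *)
Lemma formal_domination : exists2 Q, formal_forms Q &
  forall l, rnorm (formal_eval u l) ^+ 2 <= D * Q l.
Proof.
apply: (@compact_finite_intersections {ptws X -> R} X formal_forms
  (fun l => [set Q : {ptws X -> R} | rnorm (formal_eval u l) ^+ 2 <= D * Q l])).
- exact: compact_pointwise formal_forms_closed formal_forms_bounded.
- move=> l; set r := rnorm _ ^+ 2.
  have := @closed_ineq R X unit (fun _ _ => r) (fun _ Q => D * Q l).
  rewrite (_ : [set _ | _] = [set Q : {ptws X -> R} | r <= D * Q l]).
    apply=> _; first exact: cst_continuous.
    by move=> q; exact: (cvgM (cvg_cst D) (@ptws_eval_continuous R X l q)).
  by apply/seteqP; split=> q; [move/(_ tt)|move=> ? _].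
move=> s; have [N [T [on sp]]] := gram_schmidt [seq p.2 | p <- flatten s].
have Tc l : rnorm (\sum_(0 <= m < N) l m *: T m) ^+ 2 <= \sum_(0 <= m < N) sqrmod (l m).
  by rewrite rnorm_combination.
have [q fq wq] := dominated_by_D (vec_form_forms C0 um uC Tc)
  (vec_form_apriori C0 um uC N T theta1).
exists (fun l => q (coord N T l)); first exact: formal_forms_coord.
move=> l ls /=; apply: le_trans (wq _); rewrite /vec_form (vec_eval_coord um)//.
move=> p pl; apply: sp; apply/mapP; exists p => //.
elim: s ls {N T on Tc q fq wq} => //= l' s IH [->|/IH ps].
  by rewrite mem_cat pl.
by rewrite mem_cat ps orbT.
Qed.

Lemma formal_eval_cat l l' : formal_eval u (l ++ l') = formal_eval u l + formal_eval u l'.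
Proof. exact: big_cat. Qed.
Lemma formal_eval_scale k l : formal_eval u (formal_scale k l) = k *: formal_eval u l.
Proof.
rewrite /formal_eval big_map scaler_sumr; apply: eq_bigr => p _ /=.
by rewrite (morphismZ um).
Qed.
Lemma formal_eval_act a l : formal_eval u (formal_act a l) = u (oa_val a) (formal_eval u l).
Proof.
rewrite /formal_eval big_map linear_sum; apply: eq_bigr => p _ /=.
by rewrite (morphismM um).
Qed.
Lemma formal_eval_unit h : formal_eval u [:: (1, h)] = h.
Proof. by rewrite /formal_eval big_seq1/= (morphism1 um). Qed.

Lemma renorming : exists kappa : H -> R, [/\ hilbertian kappa,
  forall h, kappa h <= rnorm h ^+ 2,
  forall h, rnorm h ^+ 2 <= D * kappa h &
  forall (a : E) h, kappa (u (oa_val a) h) <= (theta * oa_norm a) ^+ 2 * kappa h].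
Proof.
have [Q [Q0 QZ Qp Qn Qa] QD] := formal_domination.
have surj h : exists l, formal_eval u l = h by exists [:: (1, h)]; exact: formal_eval_unit.
exists (quotient_form (formal_eval u) Q); split.
- apply: (quotient_hilbertian (addX := cat) (subX := fun l l' => l ++ formal_scale (-1) l')
    (sclX := formal_scale)) => //; [exact: formal_eval_cat| |exact: formal_eval_scale].
  by move=> l l'; rewrite formal_eval_cat formal_eval_scale scaleN1r.
- by move=> h; rewrite -{1}(formal_eval_unit h); apply: le_trans (Qn h); exact: quotient_le.
- move=> h; rewrite -ler_pdivrMl//; apply: quotient_ge => // l <-.
  by rewrite ler_pdivrMl.
- move=> a h; apply: quotient_scale => //; first exact: sqr_ge0.
  by move=> l <-; exists (formal_act a l); [exact: formal_eval_act|exact: Qa].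
Qed.

End renorming.
End formal_sums.

(** * Renorming *)

Section renormed_space.
Context {R : realType} (H : hilbertType R) (kappa : H -> R) (D : R).
Hypotheses (D0 : 0 < D) (hk : hilbertian kappa)
  (kle : forall h, kappa h <= rnorm h ^+ 2)
  (kge : forall h, rnorm h ^+ 2 <= D * kappa h).

Lemma kappa_definite h : kappa h = 0 -> h = 0.
Proof.
move=> h0; have := kge h; rewrite h0 mulr0 => h_le0.
apply/eqP; rewrite -normr_eq0 -rnormE.
have : rnorm h ^+ 2 == 0 by rewrite eq_le h_le0 sqr_ge0.
by rewrite expf_eq0/= => /eqP ->.
Qed.

Lemma kappa_complete : hq_complete kappa.
Proof.
move=> F FF Fc.
have Fcvg : cvg (F : set_system H).
  apply: cauchy_cvg; apply/cauchyP => e e0.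
  have eE : e = (complex.Re e)%:C by rewrite RRe_real// gtr0_real.
  have e'0 : 0 < complex.Re e by rewrite -ltcR -eE.
  have [x Fx] := Fc _ (divr_gt0 (exprn_gt0 2 e'0) D0); exists x.
  apply: filterS Fx => y /= xy; rewrite -ball_normE/= distrC -rnormE eE ltcR.
  rewrite -(@ltr_pXn2r _ 2)// ?nnegrE ?rnorm_ge0 ?(ltW e'0)//.
  by apply: le_lt_trans (kge _) _; rewrite mulrC -ltr_pdivlMr.
have /cvg_ex[l Fl] := Fcvg; exists l => e e0.
have se : 0 < (Num.sqrt e)%:C :> R[i] by rewrite ltcR sqrtr_gt0.
move/cvg_ballP : Fl => /(_ _ se); apply: filterS => y.
rewrite -ball_normE/= distrC -rnormE ltcR => yl.
apply: le_lt_trans (kle _) _; rewrite -[ltRHS]sqr_sqrtr ?(ltW e0)//.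
by rewrite ltr_pXn2r// nnegrE ?rnorm_ge0 ?sqrtr_ge0.
Qed.

Definition renormed_data := HilbertData hk kappa_definite kappa_complete.
Definition renormed : hilbertType R := hilbert_of renormed_data.

Lemma renormed_rnorm (h : H) : rnorm (h : renormed) ^+ 2 = kappa h.
Proof.
by apply: complexI; rewrite realcX rnormE [LHS](sqr_hnorm (d := renormed_data)).
Qed.

Lemma to_renormed_subproof : (idfun : H -> renormed) \in bounded_operator.
Proof.
apply: bounded_operatorP => //; exists 1 => // x.
by apply: norm_le_rnorm_sqr => //; rewrite expr1n mul1r renormed_rnorm.
Qed.

Lemma from_renormed_subproof : (idfun : renormed -> H) \in bounded_operator.
Proof.
apply: bounded_operatorP => //; exists (Num.sqrt D) => [|x]; first exact: sqrtr_ge0.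
apply: norm_le_rnorm_sqr; first exact: sqrtr_ge0.
by rewrite sqr_sqrtr ?(ltW D0)// renormed_rnorm.
Qed.

Definition to_renormed : bop H renormed := Bop to_renormed_subproof.
Definition from_renormed : bop renormed H := Bop from_renormed_subproof.

Lemma transfer_subproof (S : 'B(H)) :
  (S : renormed -> renormed) \in bounded_operator.
Proof.
apply: bounded_operatorP; first exact: (bop_linear S).
have [_ [M M0 SM]] := bounded_operatorW (valP S).
exists (M * Num.sqrt D) => [|x]; first by rewrite mulr_ge0// sqrtr_ge0.
apply: norm_le_rnorm_sqr; first by rewrite mulr_ge0// sqrtr_ge0.
rewrite !renormed_rnorm exprMn sqr_sqrtr ?(ltW D0)//.
apply: le_trans (kle _) _; apply: le_trans (rnorm_sqr_le M0 (SM x)) _.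
by rewrite -[leRHS]mulrA ler_wpM2l ?sqr_ge0//; exact: kge.
Qed.

Definition transfer (S : 'B(H)) : 'B(renormed) := Bop (transfer_subproof S).
End renormed_space.

Lemma similar_of_kappa (R : realType) (H0 : hilbertType R) (A : op_alg H0)
    (H : hilbertType R) (u : 'B(H0) -> 'B(H)) (theta D : R) (kappa : H -> R) :
  0 <= theta -> 0 < D -> unital_morphism A u -> hilbertian kappa ->
  (forall h, kappa h <= rnorm h ^+ 2) -> (forall h, rnorm h ^+ 2 <= D * kappa h) ->
  (forall (a : oa_elt A) h, kappa (u (oa_val a) h) <= (theta * oa_norm a) ^+ 2 * kappa h) ->
  exists (H' : hilbertType R) (u' : 'B(H0) -> 'B(H')),
    class_C theta A u' /\ similar_morphisms A u u'.
Proof.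
move=> t0 D0 [u1 uM uD uZ] hk kle kge ku.
exists (renormed D0 hk kle kge), (fun a => transfer D0 hk kle kge (u a)).
split; last first.
  by exists (to_renormed D0 hk kle kge), (from_renormed D0 hk kle kge).
split.
  split.
  - by apply: bopP => x; rewrite /= u1.
  - by move=> a b aA bA; apply: bopP => x; rewrite /= uM.
  - by move=> a b aA bA; apply: bopP => x; rewrite /= uD.
  - by move=> k a aA; apply: bopP => x; rewrite /= uZ.
apply: ge_ereal_sup => _ [a [aA /= a1] <-]; rewrite lee_fin.
have {}aA : a \in oa_pred A by rewrite inE.
rewrite -lecR (Re_normE (transfer D0 hk kle kge (u a))).
apply: bop_norm_le => // x; apply: norm_le_rnorm_sqr => //.
rewrite !renormed_rnorm; apply: le_trans (ku (OaElt aA) x) _.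
rewrite ler_wpM2r ?(hq_ge0 hk)// ler_pXn2r ?nnegrE ?mulr_ge0 ?oa_norm_ge0//.
by rewrite ler_piMr// -lecR Re_normE.
Qed.

Theorem theorem0p5 (R : realType) (H0 : hilbertType R) (A : set 'B(H0))
    (hA : unital_operator_algebra A) (theta c : R)
    (htheta : 1 <= theta) (hc : theta < c) :
  (forall (H : hilbertType R) (u : 'B(H0) -> 'B(H)), class_C c A u ->
     exists (H' : hilbertType R) (u' : 'B(H0) -> 'B(H')),
       class_C theta A u' /\ similar_morphisms A u u')
  <->
  (forall (H : hilbertType R) (u : 'B(H0) -> 'B(H)), bounded_morphism A u ->
     exists (H' : hilbertType R) (u' : 'B(H0) -> 'B(H')),
       class_C theta A u' /\ similar_morphisms A u u').
Proof.
split=> [sim H u [um u_fin]|sim H u [um uc]]; last first.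
  by apply: sim; split => //; apply: le_lt_trans uc (ltry _).
pose AA := OpAlg hA.
have t0 : 0 < theta by apply: lt_le_trans htheta.
have c0 : 0 <= c by rewrite ltW// (lt_trans t0).
have [K K0 uniform] := @forms_uniform R H0 AA theta c (ltW t0) c0 sim.
pose C := `|fine (opnorm A u)| + 1.
have C0 : 0 < C by rewrite ltr_wpDl.
have uC : (opnorm A u <= C%:E)%E.
  move: u_fin; rewrite /C; case: (opnorm A u) => [r _||_].
  - by rewrite lee_fin (le_trans (ler_norm _))// lerDl.
  - by rewrite ltxx.
  - exact: leNye.
have [D D0 dom] := domination t0 hc C0 K0 uniform.
have [kappa [hk kle kge ku]] := @renorming R H0 AA H theta C D u htheta (ltW C0) D0 um uC dom.
exact: (similar_of_kappa (A := AA) (ltW t0) D0 um hk kle kge ku).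
Qed.
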